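(* Let $(X,Y)$ be a dual pair with $X\subseteq\mathcal M$, let $X^1=X\cap\mathcal M^1$, and assume that $(X,Y)$ is $\nu$-decomposable for every $\nu\in X^1$. For $g\in Y$ and $\varepsilon\in\mathbb R$ let $\mathscr L_g(\varepsilon)=\inf\{D_\varphi(\mu\|\nu):\mu,\nu\in X^1,\ \int g\,d\mu-\int g\,d\nu=\varepsilon\}$, and for a non-empty $\mathcal G\subseteq Y$ let $\mathscr L_{\mathcal G}(\varepsilon)=\inf\{D_\varphi(\mu\|\nu):\mu,\nu\in X^1,\ \sup_{g\in\mathcal G}(\int g\,d\mu-\int g\,d\nu)=\varepsilon\}$ for $\varepsilon\ge0$ and $\mathscr L_{\mathcal G}(\varepsilon)=\inf\{D_\varphi(\mu\|\nu):\mu,\nu\in X^1,\ \inf_{g\in\mathcal G}(\int g\,d\mu-\int g\,d\nu)=\varepsilon\}$ for $\varepsilon<0$ (with $\inf\emptyset=+\infty$). Then for all non-empty $\mathcal G\subseteq Y$, $$\mathscr L_{\mathcal G}^\star=\Big(\inf_{g\in\mathcal G}\mathscr L_g\Big)^\star=K_{\mathcal G,X^1},\qquad\text{where }K_{\mathcal G,X^1}(t)=\sup\{K_{g,\nu}(t):g\in\mathcal G,\ \nu\in X^1\}\ \text{ for }t\in\mathbb R.$$ In particular, for any $\sigma$-ideal $\Sigma\subseteq\mathcal F$ and any non-empty $\mathcal G\subseteq L^0(\Sigma)$, let $P$ be the set of probability measures $\mu$ that vanish on every element of $\Sigma$ and satisfy $\int|g|\,d\mu<\infty$ for all $g\in\mathcal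 G$. Then for every convex lower semicontinuous $L:[0,\infty)\to\overline{\mathbb R}$, the following are equivalent: (i) $D_\varphi(\mu\|\nu)\ge L\big(d_{\mathcal G}(\mu,\nu)\big)$ for all $\mu,\nu\in P$, where $d_{\mathcal G}(\mu,\nu)=\sup_{g\in\mathcal G}|\int g\,d\mu-\int g\,d\nu|$; (ii) $D_\varphi(\mu\|\nu)\ge L\big(|\int g\,d\mu-\int g\,d\nu|\big)$ for all $g\in\mathcal G$ and $\mu,\nu\in P$; (iii) $K_{g,\nu}(t)\le L^\star(|t|)$ for all $t\in\mathbb R$, $g\in\mathcal G$ and $\nu\in P$, where $L^\star(s)=\sup_{x\ge0}\{sx-L(x)\}$.
   Context: $(\Omega,\mathcal F)$ is a measurable space with $\{\emptyset,\Omega\}\subsetneq\mathcal F$; $\mathcal M,\mathcal M^+,\mathcal M^1$ are the sets of finite signed measures, finite non-negative measures and probability measures on it; $\overline{\mathbb R}=\mathbb R\cup\{-\infty,+\infty\}$. $\mathcal M_c(\nu)=\{\mu\in\mathcal M:\mu\ll\nu\}$. For a $\sigma$-ideal $\Xi\subseteq\mathcal F$, $L^0(\Xi)$ is the space of real measurable functions modulo equality outside an element of $\Xi$; $\operatorname{ess\,im}_\Xi f=\bigcap_{\epsilon>0}\{x\in\mathbb R: f^{-1}((x-\epsilon,x+\epsilon))\notin\Xi\}$, $\operatorname{ess\,sup}_\Xi f=\sup\operatorname{ess\,im}_\Xi f$, and $L^\infty(\Xi)$ is the space of functions with bounded $\Xi$-essential range, modulo equality outside an element of $\Xi$. The subscript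 or argument $\nu$ in $\operatorname{ess\,sup}_\nu$, $L^\infty(\nu)$ means that $\Xi$ is the $\sigma$-ideal of $\nu$-null sets. Standing assumptions on $\varphi$: $\varphi:\mathbb R\to[0,+\infty]$ is convex, lower semicontinuous, $\varphi(1)=0$, $\varphi(x)=+\infty$ for $x<0$, and $\operatorname{dom}\varphi=\{x:\varphi(x)<\infty\}$ contains a neighborhood of $1$. $\varphi'(\pm\infty)=\lim_{x\to\pm\infty}\varphi(x)/x$ (so $\varphi'(-\infty)=-\infty$). Set $\psi(x)=\varphi(x+1)$. The convex conjugate of $f:\mathbb R\to\overline{\mathbb R}$ is $f^\star(y)=\sup_{x\in\mathbb R}\{xy-f(x)\}$. For $\mu\in\mathcal M$, $\nu\in\mathcal M^+$ with Lebesgue decomposition $\mu=\mu_c+\mu_s$ ($\mu_c\ll\nu$, $\mu_s\perp\nu$) and Hahn–Jordan decomposition $\mu_s=\mu_s^+-\mu_s^-$, $D_\varphi(\mu\|\nu)=\int\varphi(\frac{d\mu_c}{d\nu})d\nu+\mu_s^+(\Omega)\varphi'(\infty)-\mu_s^-(\Omega)\varphi'(-\infty)$, with $0\cdot(\pm\infty)=0$. For $\nu\in\mathcal M^1$ and $g$ measurable, $K_{g,\nu}(t)=\inf\{\int\psi^\star(tg+\lambda)\,d\nu:\lambda\in\mathbb R,\ \lambda+\operatorname{ess\,sup}_\nu(tg)\le\varphi'(\infty)\}$ for $t\in\mathbb R$ (equivalently the infimum over all $\lambda\in\mathbb R$, since $\psi^\star=+\infty$ on $(\varphi'(\infty),\infty)$).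 Decomposability: let $X\subseteq\mathcal M$ be a vector space of finite signed measures with null $\sigma$-ideal $\Xi=\{A\in\mathcal F:\forall\mu\in X,|\mu|(A)=0\}$, $Y$ a vector space of measurable functions, $\nu\in X\cap\mathcal M^+$. The pair $(X,Y)$ is $\nu$-decomposable if (1) the pairing $(\mu,h)\mapsto\int h\,d\mu$ puts $X$ and $Y$ in separating duality (it is finite, for each nonzero $\mu\in X$ some $h\in Y$ has $\int h\,d\mu\ne0$, and for each nonzero $h\in Y$ some $\mu\in X$ has $\int h\,d\mu\neq0$); (2) $\{\mu\in\mathcal M_c(\nu): d\mu/d\nu\in L^\infty(\nu)\}\subseteq X$ and $L^\infty(\Xi)\subseteq Y\subseteq L^0(\Xi)$; (3) for every $A\in\mathcal F\setminus\Xi$ there is a nonzero $\mu\in X\cap\mathcal M^+$ with $\mu(\Omega\setminus A)=0$.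
   Formalization: L_G^*=K is proved assuming d_G(mu,nu)<oo whenever D(mu||nu)<oo (else only <=); (iii)=>(i) assumes that inf L<=0 implies L(0)<=0 and that L is never -oo or identically -oo; L(+oo) means the limit of L at infinity. Without these the English is false or undefined. *)

(* Defs.v *)
From HB Require Import structures.
From mathcomp Require Import all_boot all_order all_algebra.
From mathcomp Require Import all_classical all_reals all_analysis.

Set Implicit Arguments.
Unset Strict Implicit.
Unset Printing Implicit Defensive.

Import Order.TTheory GRing.Theory Num.Theory.
Import numFieldNormedType.Exports.

Local Open Scope classical_set_scope.
Local Open Scope ring_scope.
Local Open Scope ereal_scope.
Local Open Scope charge_scope.

Section convex_analysis.
Context {R : realType}.
Implicit Types (f phi : R -> \bar R).

(* Convexity of the epigraph, so that functions taking both values -oo and +oo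
   are covered without any convention on +oo - oo. *)
Definition ereal_convex_on (D : set R) f : Prop :=
  convex_set [set p : (R^o * R^o)%type | D p.1 /\ f p.1 <= p.2%:E].

Definition conjugate f (y : R) : \bar R :=
  ereal_sup [set (x * y)%:E - f x | x in [set: R]].

(* the conjugate of f restricted to the half-line of nonnegative reals *)
Definition conjugate_ge0 f (s : R) : \bar R :=
  ereal_sup [set (s * x)%:E - f x | x in `[0%R, +oo[].

Definition slope_pinfty f : \bar R := lim (f x * (x^-1)%:E @[x --> +oo%R]).

Definition slope_ninfty f : \bar R := lim (f x * (x^-1)%:E @[x --> -oo%R]).

Record divergence_generator phi : Prop := {
  divgen_ge0 : forall x, 0 <= phi x;
  divgen_convex : ereal_convex_on setT phi;
  divgen_lsc : lower_semicontinuous phi;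
  divgen_at1 : phi 1%R = 0;
  divgen_neg : forall x, (x < 0)%R -> phi x = +oo;
  divgen_dom1 : \forall x \near (1%R : R), phi x < +oo }.

Definition shift1 phi : R -> \bar R := fun x => phi (x + 1)%R.

(* Lower semicontinuity is relative to the half-line; the values of f at
   negative reals play no role. *)
Definition convex_lsc_ge0 f : Prop :=
  ereal_convex_on `[0%R, +oo[ f /\
  lower_semicontinuous (f : subspace `[0%R, +oo[ -> \bar R).

(* The value at +oo is lim_{x -> +oo} f x, i.e. f is extended by lower
   semicontinuity to [0, +oo]. *)
Definition extend_pinfty f (x : \bar R) : \bar R :=
  if x is r%:E then f r else lim (f y @[y --> +oo%R]).

End convex_analysis.

Section essential_range.
Context {d : measure_display} {T : measurableType d} {R : realType}.
Implicit Types (Xi : set (set T)) (f : T -> R).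

Definition sigma_ideal Xi : Prop :=
  [/\ Xi `<=` measurable,
      Xi set0,
      (forall A B, Xi B -> measurable A -> A `<=` B -> Xi A) &
      (forall F : (set T)^nat, (forall n, Xi (F n)) -> Xi (\bigcup_n F n))].

Definition ess_im Xi f : set R :=
  [set x | forall e : R, (0 < e)%R -> ~ Xi (f @^-1` `](x - e)%R, (x + e)%R[)].

Definition ideal_ess_sup Xi f : \bar R :=
  ereal_sup [set x%:E | x in ess_im Xi f].

(* L^0 and L^oo are handled through representatives; [ideal_eq0] is the
   vanishing of the class of f modulo Xi. *)
Definition Linfty Xi f : Prop :=
  measurable_fun setT f /\ bounded_set (ess_im Xi f : set R^o).

Definition ideal_eq0 Xi f : Prop :=
  exists2 A, Xi A & forall x, ~ A x -> f x = 0%R.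

Definition null_ideal (nu : {measure set T -> \bar R}) : set (set T) :=
  [set A | measurable A /\ nu A = 0].

End essential_range.

Section signed_measures.
Context {d : measure_display} {T : measurableType d} {R : realType}.
Implicit Types (mu : {charge set T -> \bar R})
  (nu : {finite_measure set T -> \bar R}).

Definition hahn_pos mu : set T := sval (cid (Hahn_decomposition mu)).

Definition hahn_neg mu : set T :=
  sval (cid (svalP (cid (Hahn_decomposition mu)))).

Lemma hahnP mu : hahn_decomposition mu (hahn_pos mu) (hahn_neg mu).
Proof. exact: (svalP (cid (svalP (cid (Hahn_decomposition mu))))). Qed.

Definition pos_part mu : {finite_measure set T -> \bar R} :=
  jordan_pos (hahnP mu).

Definition neg_part mu : {finite_measure set T -> \bar R} :=
  jordan_neg (hahnP mu).

Definition variation mu : {measure set T -> \bar R} :=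
  charge_variation (hahnP mu).

Definition integral_charge mu (h : T -> R) : \bar R :=
  \int[pos_part mu]_x (h x)%:E - \int[neg_part mu]_x (h x)%:E.

Definition mutually_singular mu nu : Prop :=
  exists N, [/\ measurable N, nu N = 0 & variation mu (~` N) = 0].

Definition lebesgue_decomposition mu nu
    (p : {charge set T -> \bar R} * {charge set T -> \bar R}) : Prop :=
  [/\ forall A, measurable A -> mu A = p.1 A + p.2 A,
      p.1 `<< nu & mutually_singular p.2 nu].


Lemma lebesgue_decomposition_ex mu nu : exists p, lebesgue_decomposition mu nu p.
Proof.
have Vfin A : measurable A -> variation mu A \is a fin_num.
  by move=> mA; rewrite /variation /= /charge_variation fin_numD !fin_num_measure.
have muV A : measurable A -> variation mu A = 0 -> mu A = 0.
  move=> mA VA; apply/eqP; rewrite -abse_eq0 eq_le abse_ge0 andbT -VA.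
  exact: abse_charge_variation.
pose S := [set variation mu N | N in [set N | measurable N /\ nu N = 0]].
have S0 : S (variation mu set0) by exists set0 => //; rewrite measure0.
have cfin : ereal_sup S \is a fin_num.
  rewrite ge0_fin_numE.
    apply: (@le_lt_trans _ _ (variation mu setT)).
      apply: ge_ereal_sup => _ [N [mN _] <-].
      by apply: le_measure => //; rewrite inE.
    by rewrite -ge0_fin_numE// Vfin.
  exact: (le_trans _ (ereal_sup_ubound S0)).
have /choice[F FP] (n : nat) : exists N, [/\ measurable N, nu N = 0 &
    ereal_sup S - (n.+1%:R^-1)%:E < variation mu N].
  have e0 : (0 < (n.+1%:R^-1 : R))%R by rewrite invr_gt0.
  have [_ [N [mN N0] <-] h] := ub_ereal_sup_adherent e0 cfin.
  by exists N.
pose N := \bigcup_n F n.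
have mF n : measurable (F n) by have [] := FP n.
have mN : measurable N by exact: bigcupT_measurable.
have nuN : nu N = 0.
  apply/eqP; rewrite eq_le measure_ge0 andbT.
  have := @measure_sigma_subadditive _ _ _ nu _ F mF mN (@subset_refl _ _).
  move=> /le_trans; apply.
  by rewrite eseries0// => n _ _; have [] := FP n.
have cN : ereal_sup S <= variation mu N.
  apply/lee_addgt0Pr => e e0.
  have [n /ltW ne] := ltr_add_invr e0.
  have [_ _ /ltW h] := FP n.
  rewrite add0r in ne.
  rewrite -leeBlDr//; apply: le_trans (le_trans h _).
    by rewrite leeD2l// leeN2 lee_fin.
  by apply: le_measure; rewrite ?inE//; exact: bigcup_sup.
have maxN A : measurable A -> A `<=` ~` N -> nu A = 0 -> variation mu A = 0.
  move=> mA AN A0.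
  have VNA : variation mu N + variation mu A <= ereal_sup S.
    rewrite -measureU//; last first.
      by apply/disjoints_subset => x Nx /AN; exact.
    apply: ereal_sup_ubound; exists (N `|` A) => //; split.
      exact: measurableU.
    apply/eqP; rewrite eq_le measure_ge0 andbT.
    have : nu (N `|` A) <= nu N + nu A by exact: measureU2.
    by rewrite nuN A0 adde0.
  apply/eqP; rewrite eq_le measure_ge0 andbT.
  have := le_trans VNA cN.
  by rewrite -{2}(adde0 (variation mu N)) leeD2lE// Vfin.
have mNC : measurable (~` N) by exact: measurableC.
exists (crestr0 mu mNC : {charge set T -> \bar R},
        crestr0 mu mN : {charge set T -> \bar R}); split => /=.
- move=> A mA; rewrite /crestr0 mem_set// /crestr.
  rewrite addeC -chargeU; [|exact: measurableI..|].
    by rewrite -setIUr setUv setIT.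
  by rewrite setIACA setICr setI0.
- apply/null_content_dominatesP => A mA nuA /=.
  rewrite /crestr0 mem_set// /crestr; apply: muV; first exact: measurableI.
  apply: maxN; [exact: measurableI|exact: subIsetr|].
  apply/eqP; rewrite eq_le measure_ge0 andbT -nuA.
  by apply: le_measure; rewrite ?inE//; exact: measurableI.
- exists N; split => //.
  have H B (mB : measurable B) : crestr0 (crestr0 mu mN) mB (~` N) = 0.
    rewrite {1}/crestr0 mem_set// /crestr /crestr0 mem_set; last first.
      exact: measurableI.
    by rewrite /crestr setIAC setICl set0I charge0.
  rewrite /variation /= /charge_variation jordan_posE jordan_negE.
  by rewrite cjordan_posE cjordan_negE !H oppe0 adde0.
Qed.

Definition lebesgue_ac mu nu : {charge set T -> \bar R} :=
  (sval (cid (lebesgue_decomposition_ex mu nu))).1.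

Definition lebesgue_sing mu nu : {charge set T -> \bar R} :=
  (sval (cid (lebesgue_decomposition_ex mu nu))).2.

Definition radon_nikodym mu nu : T -> R := fine \o 'd mu '/d nu.

End signed_measures.

Section divergence.
Context {d : measure_display} {T : measurableType d} {R : realType}.
Implicit Types (phi : R -> \bar R) (g : T -> R) (G : set (T -> R)).

Definition divergence phi (mu : {charge set T -> \bar R})
    (nu : {finite_measure set T -> \bar R}) : \bar R :=
  \int[nu]_x phi (radon_nikodym (lebesgue_ac mu nu) nu x)
  + pos_part (lebesgue_sing mu nu) setT * slope_pinfty phi
  - neg_part (lebesgue_sing mu nu) setT * slope_ninfty phi.

Definition prob_divergence phi (mu nu : probability T R) : \bar R :=
  divergence phi (charge_of_finite_measure mu) nu.

Definition mean_gap g (mu nu : probability T R) : \bar R :=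
  \int[mu]_x (g x)%:E - \int[nu]_x (g x)%:E.

Definition ipm G (mu nu : probability T R) : \bar R :=
  ereal_sup [set `|mean_gap g mu nu| | g in G].

Definition centered_cumulant phi g (nu : probability T R) (t : R) : \bar R :=
  ereal_inf [set \int[nu]_x conjugate (shift1 phi) (t * g x + lam)%R
    | lam in [set lam : R |
        lam%:E + ideal_ess_sup (null_ideal nu) (fun x => t * g x)%R
          <= slope_pinfty phi]].

Section over_a_set_of_probabilities.
Variables (phi : R -> \bar R) (P : set (probability T R)).

Definition lower_bound_fun g (eps : R) : \bar R :=
  ereal_inf [set D | exists mu nu, [/\ P mu, P nu,
    mean_gap g mu nu = eps%:E & D = prob_divergence phi mu nu]].

Definition lower_bound_family G (eps : R) : \bar R :=
  if (0 <= eps)%R then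
    ereal_inf [set D | exists mu nu, [/\ P mu, P nu,
      ereal_sup [set mean_gap g mu nu | g in G] = eps%:E &
      D = prob_divergence phi mu nu]]
  else
    ereal_inf [set D | exists mu nu, [/\ P mu, P nu,
      ereal_inf [set mean_gap g mu nu | g in G] = eps%:E &
      D = prob_divergence phi mu nu]].

Definition inf_lower_bound G (eps : R) : \bar R :=
  ereal_inf [set lower_bound_fun g eps | g in G].

Definition sup_cumulant G (t : R) : \bar R :=
  ereal_sup [set K | exists g nu,
    [/\ G g, P nu & K = centered_cumulant phi g nu t]].

End over_a_set_of_probabilities.

Definition admissible_probabilities (Sigma : set (set T)) G :
    set (probability T R) :=
  [set mu | (forall A, Sigma A -> mu A = 0) /\
            (forall g, G g -> \int[mu]_x `|(g x)%:E| < +oo)].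

End divergence.

Section decomposability.
Context {d : measure_display} {T : measurableType d} {R : realType}.
Implicit Types (X : set (charge T R)) (Y : set (T -> R)).

(* A charge is a function on all subsets of T; a signed measure is a charge up
   to its values on non-measurable sets, so nullity is only tested on
   measurable sets.  Members of X and Y are representatives: for a decomposable
   pair, the inclusions below force X to be closed under changing a charge off
   the measurable sets, and Y under changing a measurable function on an
   element of the null ideal. *)
Definition charge_subspace X : Prop :=
  [/\ X czero,
      (forall mu1 mu2, X mu1 -> X mu2 -> X (cadd mu1 mu2)) &
      (forall (a : R) mu, X mu -> X (cscale a mu))].

Definition measurable_fun_subspace Y : Prop :=
  [/\ (forall h, Y h -> measurable_fun setT h),
      Y (fun=> 0%R),
      (forall h1 h2, Y h1 -> Y h2 -> Y (fun x => h1 x + h2 x)%R) &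
      (forall (a : R) h, Y h -> Y (fun x => a * h x)%R)].

Definition null_ideal_of X : set (set T) :=
  [set A | measurable A /\ forall mu, X mu -> variation mu A = 0].

Definition dual_pair X Y : Prop :=
  [/\ (forall mu h, X mu -> Y h ->
         (variation mu).-integrable setT (EFin \o h)),
      (forall mu, X mu -> (exists2 A, measurable A & mu A <> 0) ->
         exists2 h, Y h & integral_charge mu h <> 0) &
      (forall h, Y h -> ~ ideal_eq0 (null_ideal_of X) h ->
         exists2 mu, X mu & integral_charge mu h <> 0)].

Record decomposable X Y (nu : {finite_measure set T -> \bar R}) : Prop := {
  decomp_base : X (charge_of_finite_measure nu);
  decomp_duality : dual_pair X Y;
  decomp_bounded_density : forall mu : {charge set T -> \bar R},
    mu `<< nu -> Linfty (null_ideal nu) (radon_nikodym mu nu) -> X mu;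
  decomp_Linfty : forall h, Linfty (null_ideal_of X) h -> Y h;
  decomp_L0 : forall h, Y h -> measurable_fun setT h;
  decomp_support : forall A, measurable A -> ~ null_ideal_of X A ->
    exists mu : {finite_measure set T -> \bar R},
      [/\ X (charge_of_finite_measure mu), mu setT <> 0 & mu (~` A) = 0] }.

Definition probabilities_in X : set (probability T R) :=
  [set mu | X (charge_of_finite_measure mu)].

End decomposability.

(* Main.v *)
Require Import Defs.
From mathcomp Require Import all_boot all_order all_algebra.
From mathcomp Require Import all_classical all_reals all_analysis.
From HB Require Import structures.
From mathcomp Require Import measurable_realfun ring lra.

(* Everything reduces to the identity sup_{g,nu} K_{g,nu}(t) =
   sup_{g,mu,nu} (t (mu(g) - nu(g)) - D(mu || nu)), valid for every set of
   probability measures that integrates G and is closed under bounded densities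
   and binary mixtures.

   For "<=", fix nu and g.  The maximal value of t nu(g (f - 1)) - nu(phi o f)
   over bounded densities f with nu(f) = 1 + c is a concave function of c, finite
   near c = 0; a supergradient at 0 is a multiplier lam for which the
   unconstrained Lagrangian is still bounded by the value at 0, and its supremum
   over f is int psi^*(t g + lam) d nu.  So the infimum over lam is attained.

   For ">=", when mu << nu integrate the Young inequality
   (t g + lam) (f - 1) <= psi^*(t g + lam) + phi(f); for general mu replace nu by
   (1 - s) nu + s mu and let s tend to 0.

   A convex L on the half-line is eventually monotone, which gives its limit at
   infinity and (i) <-> (ii); (iii) -> (ii) separates a point strictly below the
   graph of L from the epigraph by a line of nonnegative slope. *)

Set Implicit Arguments.
Unset Strict Implicit.
Unset Printing Implicit Defensive.

Import Order.TTheory GRing.Theory Num.Theory.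
Import numFieldNormedType.Exports.

Local Open Scope classical_set_scope.
Local Open Scope ring_scope.
Local Open Scope ereal_scope.
Local Open Scope charge_scope.

(* lra and nra fail in the presence of hypotheses on extended reals. *)
Ltac clear_ereal := repeat match goal with
  | H : forall _ : _, _ |- _ => clear H
  | H : is_true (@Order.le ereal_display _ _ _) |- _ => clear H
  | H : is_true (@Order.lt ereal_display _ _ _) |- _ => clear H
  end;
  try match goal with
  | |- is_true (@Order.le ereal_display _ _ _) => exfalso
  | |- is_true (@Order.lt ereal_display _ _ _) => exfalso
  end.
Ltac rlra := intros; clear_ereal; lra.
Ltac rnra := intros; clear_ereal; nra.

(** * Convex functions on the half-line: monotonicity, limits and separation *)

Section convex_functions.
Context {R : realType}.
Implicit Types (D : set R) (f L : R -> \bar R).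

Lemma ereal_convex_on_comb D f (x y a b s : R) : ereal_convex_on D f ->
  D x -> D y -> f x <= a%:E -> f y <= b%:E -> (0 <= s <= 1)%R ->
  f (s * x + (1 - s) * y)%R <= (s * a + (1 - s) * b)%:E.
Proof.
move=> cf Dx Dy fa fb s01.
have := cf (x, a) (y, b) (Itv01 (proj1 (andP s01)) (proj2 (andP s01))).
by rewrite !inE /= => /(_ (conj Dx fa) (conj Dy fb)) [].
Qed.

Lemma ereal_convex_on_le D f (x y z a b : R) : ereal_convex_on D f ->
  D x -> D z -> f x <= a%:E -> f z <= b%:E -> (x <= y <= z)%R -> (x < z)%R ->
  f y <= (((z - y) * a + (y - x) * b) / (z - x))%:E.
Proof.
move=> cf Dx Dz fa fb /andP[xy yz] xz.
have zx0 : (z - x != 0)%R by rewrite subr_eq0 gt_eqF.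
have s01 : (0 <= (z - y) / (z - x) <= 1)%R.
  rewrite ler_pdivlMr ?subr_gt0// mul0r ler_pdivrMr ?subr_gt0// mul1r.
  by apply/andP; split; rlra.
have := ereal_convex_on_comb cf Dx Dz fa fb s01.
have -> : ((z - y) / (z - x) * x + (1 - (z - y) / (z - x)) * z)%R = y by field.
by have -> : ((z - y) / (z - x) * a + (1 - (z - y) / (z - x)) * b)%R =
  (((z - y) * a + (y - x) * b) / (z - x))%R by field.
Qed.

(** Heights in the epigraph are real, so [M] is first replaced by any real number above it; for
    [M = -oo] these reals are arbitrarily low. *)
Lemma ereal_convex_on_le_max D f (x y z : R) (M : \bar R) : ereal_convex_on D f ->
  D x -> D z -> f x <= M -> f z <= M -> (x <= y <= z)%R -> f y <= M.
Proof.
move=> cf Dx Dz fx fz /andP[xy yz].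
have [xz|zx] := ltP x z; last first.
  by have -> : y = x by apply/eqP; rewrite eq_le xy (le_trans yz zx).
have real_bound (r : R) : M <= r%:E -> f y <= r%:E.
  move=> Mr; have := @ereal_convex_on_le _ _ x y z r r cf Dx Dz
    (le_trans fx Mr) (le_trans fz Mr).
  rewrite xy yz => /(_ isT xz).
  have -> : ((z - y) * r + (y - x) * r)%R = (r * (z - x))%R by ring.
  by rewrite mulfK ?subr_eq0 ?gt_eqF.
case: M => [r||] in fx fz real_bound *; [exact: real_bound|exact: leey|].
case: (f y) real_bound => [r||] H //.
  by have := H (r - 1)%R (leNye _); rewrite lee_fin; rlra.
exact: (H 0%R (leNye _)).
Qed.

(** Once [L] has strictly increased from [a] to [b], convexity forbids any later decrease; if it
    never strictly increases, it is nonincreasing from 0 on. *)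
Lemma ereal_convex_on_eventually_monotone L : ereal_convex_on `[0%R, +oo[ L ->
  exists2 b : R, (0 <= b)%R &
    (forall x y, (b <= x)%R -> (x <= y)%R -> L x <= L y) \/
    (forall x y, (b <= x)%R -> (x <= y)%R -> L y <= L x).
Proof.
move=> cL; have [[a [b [a0 ab Lab]]]|nex] :=
  pselect (exists a b, [/\ (0 <= a)%R, (a <= b)%R & L a < L b]).
  exists b; first exact: le_trans ab.
  left=> x y bx xy.
  have Da : `[0%R, +oo[%classic a by rewrite /= in_itv /= andbT.
  have D_ c : (b <= c)%R -> `[0%R, +oo[%classic c.
    by move=> bc; rewrite /= in_itv /= andbT (le_trans a0)// (le_trans ab).
  rewrite leNgt; apply/negP => Lyx.
  have Lba c : (b <= c)%R -> L c <= L a -> False.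
    move=> bc Lca; move: Lab; apply/negP; rewrite -leNgt.
    by apply: (ereal_convex_on_le_max cL Da (D_ _ bc)) => //; rewrite ab bc.
  have Lxa : L x <= L a.
    have [|Lay] := leP (L y) (L a); first by move/(Lba y (le_trans bx xy)).
    have : L x <= L y.
      apply: (ereal_convex_on_le_max cL Da (D_ _ (le_trans bx xy))) => //.
        exact: ltW.
      by rewrite (le_trans ab bx) xy.
    by rewrite leNgt Lyx.
  exact: (Lba x).
exists 0%R => //; right=> x y x0 xy; rewrite leNgt; apply/negP => Lxy.
by apply: nex; exists x, y.
Qed.

Lemma eventually_nondecreasing_cvge f (b : R) :
  (forall x y, (b <= x)%R -> (x <= y)%R -> f x <= f y) ->
  f x @[x --> +oo%R] --> ereal_sup (range (fun x => f (Num.max b x))).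
Proof.
move=> ndf.
have : {homo (fun x => f (Num.max b x)) : x y / (x <= y)%R >-> x <= y}.
  move=> x y xy; apply: ndf; first by rewrite le_max lexx.
  by rewrite ge_max !le_max lexx/= xy orbT.
move/nondecreasing_cvge; apply: cvg_trans; apply: near_eq_cvg.
near=> x; have bx : (b <= x)%R by near: x; apply: nbhs_pinfty_ge; rewrite num_real.
by rewrite max_r.
Unshelve. all: by end_near. Qed.

Lemma ereal_convex_on_cvg_pinfty L : ereal_convex_on `[0%R, +oo[ L ->
  cvg (L x @[x --> +oo%R]).
Proof.
move=> /ereal_convex_on_eventually_monotone[b b0 [nd|ni]].
  by apply: cvgP; exact: eventually_nondecreasing_cvge nd.
rewrite -is_cvgeNE; apply: cvgP; apply: (@eventually_nondecreasing_cvge _ b).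
by move=> x y bx xy /=; rewrite leeN2 ni.
Qed.

Lemma lsc_ge0_near L (x c : R) :
  lower_semicontinuous (L : subspace `[0%R, +oo[ -> \bar R) ->
  (0 <= x)%R -> c%:E < L x ->
  exists2 e : R, (0 < e)%R &
    forall y, (0 <= y)%R -> (`|x - y| < e)%R -> c%:E < L y.
Proof.
move=> lL x0 cL; have [V + VL] := lL x c cL.
have xD : `[0%R, +oo[%classic x by rewrite /= in_itv/= andbT.
move=> xV; have : within `[0%R, +oo[%classic (nbhs x) V by rewrite nbhs_subspace_in.
move=> /nbhs_ballP[e /= e0 eV].
exists e => // y y0 xy; apply: VL; apply: eV => //=.
by rewrite in_itv/= andbT.
Qed.

(* The slope is the supremum of the slopes of the chords joining (x, c) to the
   points of the epigraph to the left of x; it is nonnegative because the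
   chord to the origin is, and finite because lower semicontinuity bounds L
   from below on [0, x]. *)
Lemma convex_lsc_ge0_separation L (x c : R) : convex_lsc_ge0 L ->
  (forall y, (0 <= y)%R -> -oo < L y) -> L 0%R <= 0 ->
  (0 <= x)%R -> (0 < c)%R -> c%:E < L x ->
  exists2 s : R, (0 <= s)%R &
    forall y, (0 <= y)%R -> (c + s * (y - x))%:E <= L y.
Proof.
move=> [cL lL] Lny L0 x0' c0 cLx.
have D_ (y : R) : (0 <= y)%R -> `[0%R, +oo[%classic y.
  by move=> ?; rewrite /= in_itv/= andbT.
have x0 : (0 < x)%R.
  rewrite lt_neqAle x0' andbT; apply/eqP => xE; move: cLx; rewrite -xE.
  by apply/negP; rewrite -leNgt (le_trans L0)// lee_fin ltW.
have /fineK L0E : L 0%R \is a fin_num.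
  by rewrite fin_numE (gt_eqF (Lny _ _))//= lt_eqF// (le_lt_trans L0)// ltry.
set l0 := fine (L 0%R) in L0E.
have [e e0 He] : exists2 e : R, (0 < e)%R &
    forall y, (0 <= y)%R -> (`|0 - y| < e)%R -> (l0 - 1)%:E < L y.
  by apply: lsc_ge0_near => //; rewrite -L0E lte_fin; rlra.
pose m := (e / 2)%R.
have m0 : (0 < m)%R by rewrite /m; rlra.
(* Lower bound on [[0, x]]: semicontinuity gives it within [e] of 0; for larger [y] the chord from 0
   to [y] lies above [L m], hence above [l0 - 1], at [m = e / 2]. *)
have lowb y r : (0 <= y <= x)%R -> L y <= r%:E -> (l0 - 1 - x / m <= r)%R.
  move=> /andP[y0 yx] Lyr.
  have xm0 : (0 <= x / m)%R by rewrite divr_ge0// ltW.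
  have [ye|ey] := ltP y e.
    have := lt_le_trans (He y y0 _) Lyr.
    by rewrite sub0r normrN ger0_norm// lte_fin => /(_ ye); rlra.
  have Hm : (l0 - 1)%:E < L m.
    by apply: He; [exact: ltW|rewrite sub0r normrN ger0_norm ?ltW// /m; rlra].
  have my : (m <= y)%R by rewrite /m; rlra.
  have y0' : (0 < y)%R by rlra.
  have := @ereal_convex_on_le _ _ 0 m y l0 r cL (D_ 0%R (lexx _)) (D_ _ y0).
  rewrite L0E lexx (ltW m0) my => /(_ isT Lyr isT y0') /(lt_le_trans Hm).
  rewrite lte_fin !subr0 ltr_pdivlMr// => H.
  have : ((l0 - 1 - r) * m <= x)%R by rnra.
  by rewrite -ler_pdivlMr//; rlra.
(* The point [(x, c)] lies strictly below every chord over [x], so each slope to its left is less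
   than each slope to its right. *)
have cross y z r q : (0 <= y < x)%R -> (x < z)%R -> L y <= r%:E -> L z <= q%:E ->
    (0 < (z - x) * (r - c) + (x - y) * (q - c))%R.
  move=> /andP[y0 yx] xz Lyr Lzq.
  have := @ereal_convex_on_le _ _ y x z r q cL (D_ _ y0) (D_ z _) Lyr Lzq.
  rewrite (ltW yx) (ltW xz) => /(_ _ isT (lt_trans yx xz)) H.
  have := lt_le_trans cLx (H _).
  by rewrite lte_fin ltr_pdivlMr; [move=> /(_ ltac:(rlra)); rlra|rlra].
have [n n0 Hn] := lsc_ge0_near lL x0' cLx.
pose S := [set k | exists y r,
  [/\ (0 <= y < x)%R, L y <= r%:E & k = ((c - r) / (x - y))%R]].
have S0 : S ((c - 0) / (x - 0))%R.
  by exists 0%R, 0%R; split => //; rewrite lexx.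
have ubS : has_ubound S.
  (* Within [n] of [x], [L] exceeds [c] and the slope is negative; farther away [lowb] bounds the
     numerator and the denominator is at least [n]. *)
  exists (Num.max 0 ((c - (l0 - 1 - x / m)) / n))%R => _ [y [r [/andP[y0 yx] Lyr ->]]].
  rewrite le_max; have [xyn|nxy] := ltP (x - y)%R n.
    apply/orP; left; rewrite ler_pdivrMr ?subr_gt0// mul0r subr_le0.
    have := lt_le_trans (Hn y y0 _) Lyr.
    rewrite ger0_norm ?subr_ge0 ?(ltW yx)// lte_fin => /(_ xyn).
    exact: ltW.
  have rl : (l0 - 1 - x / m <= r)%R by apply: (lowb y) => //; rewrite y0 ltW.
  have [cr|rc] := lerP c r.
    by apply/orP; left; rewrite ler_pdivrMr ?subr_gt0// mul0r subr_le0.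
  apply/orP; right; apply: (@le_trans _ _ ((c - r) / n))%R.
    by rewrite ler_pM2l ?subr_gt0// lef_pV2 ?posrE// subr_gt0.
  by rewrite ler_pM2r ?invr_gt0//; rlra.
have supS : has_sup S by split => //; exists ((c - 0) / (x - 0))%R.
exists (sup S).
  apply: (le_trans _ (ub_le_sup ubS S0)).
  by rewrite !subr0 divr_ge0// ltW.
move=> y y0; have [yx|xy|->] := ltgtP y x; last by rewrite subrr mulr0 addr0 ltW.
  case Ly : (L y) => [r||]; [|exact: leey|by have := Lny _ y0; rewrite Ly].
  have : ((c - r) / (x - y) <= sup S)%R.
    by apply: ub_le_sup => //; exists y, r; split; rewrite ?Ly// y0.
  by rewrite ler_pdivrMr ?subr_gt0// lee_fin; rlra.
case Ly : (L y) => [r||]; [|exact: leey|by have := Lny _ y0; rewrite Ly].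
have : (sup S <= (r - c) / (y - x))%R.
  apply: ge_sup; first by exists ((c - 0) / (x - 0))%R.
  move=> _ [z [q [/andP[z0 zx] Lzq ->]]].
  have := cross z y q r; rewrite z0 zx Ly => /(_ isT xy Lzq (lexx _)) H.
  rewrite ler_pdivrMr ?subr_gt0// mulrAC ler_pdivlMr ?subr_gt0//; rlra.
by rewrite ler_pdivlMr ?subr_gt0// lee_fin; rlra.
Qed.

End convex_functions.

(** * Divergence generators and measurable approximation of the conjugate *)

Section divergence_generators.
Context {R : realType} (phi : R -> \bar R).
Hypothesis hphi : divergence_generator phi.

Lemma divergence_generator_measurable : measurable_fun setT phi.
Proof. by apply: lower_semicontinuous_measurable; exact: divgen_lsc hphi. Qed.

Lemma conjugate_shift_ub (x y : R) :
  (x * y)%:E - phi (x + 1)%R <= conjugate (shift1 phi) y.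
Proof. by apply: ereal_sup_ubound; exists x. Qed.

Lemma conjugate_shift_ge0 (y : R) : 0 <= conjugate (shift1 phi) y.
Proof.
by have := conjugate_shift_ub 0 y;
  rewrite mul0r (add0r (1%R : R)) (divgen_at1 hphi) sube0.
Qed.

(** The quotient is nondecreasing on [[1, +oo[]: the chord from [(1, 0)] gives [phi x <= (x - 1) /
    (y - 1) * phi y <= x / y * phi y]. *)
Lemma slope_pinfty_cvg : cvg (phi x * (x^-1)%:E @[x --> +oo%R]).
Proof.
apply: cvgP; apply: (@eventually_nondecreasing_cvge _ _ 1%R) => x y x1 xy.
have x0 : (0 < x)%R by rlra.
have y0 : (0 < y)%R by rlra.
have phi0 := divgen_ge0 hphi.
case phiy : (phi y) => [r||]; last by have := phi0 y; rewrite phiy.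
- have r0 : (0 <= r)%R by have := phi0 y; rewrite phiy lee_fin.
  have [y1|y1] := ltP 1%R y; last first.
    have -> : x = 1%R by apply/eqP; rewrite eq_le; apply/andP; split; rlra.
    by rewrite (divgen_at1 hphi) mul0e -EFinM lee_fin mulr_ge0// invr_ge0 ltW.
  have := @ereal_convex_on_le _ _ _ 1 x y 0 r (divgen_convex hphi) I I.
  rewrite (divgen_at1 hphi) phiy x1 xy => /(_ (lexx _) (lexx _) isT y1) H.
  apply: (@le_trans _ _ ((((y - x) * 0 + (x - 1) * r) / (y - 1))%:E * (x^-1)%:E)).
    by rewrite lee_wpmul2r// lee_fin invr_ge0 ltW.
  rewrite -!EFinM lee_fin ler_pdivrMr// mulrAC ler_pdivlMr// mulrAC.
  by rewrite ler_pdivrMr ?subr_gt0//; rnra.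
- by rewrite gt0_mulye ?leey// lte_fin invr_gt0.
Qed.

Lemma slope_pinfty_ge0 : 0 <= slope_pinfty phi.
Proof.
apply: lime_ge; first exact: slope_pinfty_cvg.
near=> x; rewrite mule_ge0 ?(divgen_ge0 hphi)// lee_fin invr_ge0.
by near: x; apply: nbhs_pinfty_ge; rewrite num_real.
Unshelve. all: by end_near. Qed.

(** Young's inequality gives [phi x >= (x - 1) y - M] with [M] the conjugate at [y]; dividing by
    large [x] leaves [y]. Hence a finite integral of the conjugate enforces the constraint on [lam]
    in the cumulant. *)
Lemma conjugate_shift_lty_le (y : R) :
  conjugate (shift1 phi) y < +oo -> y%:E <= slope_pinfty phi.
Proof.
have [y0 _|y0 psiy] := lerP y 0.
  by apply: le_trans slope_pinfty_ge0; rewrite lee_fin.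
have /fineK M_ : conjugate (shift1 phi) y \is a fin_num.
  by rewrite ge0_fin_numE// conjugate_shift_ge0.
set M := fine _ in M_.
have M0 : (0 <= M)%R by rewrite -lee_fin M_ conjugate_shift_ge0.
apply/lee_subgt0Pr => e e0; apply: lime_ge; first exact: slope_pinfty_cvg.
near=> x.
have x1 : (1 <= x)%R by near: x; apply: nbhs_pinfty_ge; rewrite num_real.
(* Beyond this threshold the error [(y + M) / x] is at most [e]. *)
have xMe : ((y + M) / e <= x)%R by near: x; apply: nbhs_pinfty_ge; rewrite num_real.
have x0 : (0 < x)%R by rlra.
have := conjugate_shift_ub (x - 1) y; rewrite subrK -M_.
case phix : (phi x) => [r||]; last by have := divgen_ge0 hphi x; rewrite phix.
- rewrite -EFinB -EFinM -EFinB !lee_fin => H.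
  rewrite ler_pdivlMr//; move: xMe; rewrite ler_pdivrMr//; rlra.
- by rewrite gt0_mulye ?leey// lte_fin invr_gt0.
Unshelve. all: by end_near. Qed.

(** Enumeration of the rationals by their codes; an index coding no rational yields 0. *)
Let rational (n : nat) : R := ratr (odflt 0%R (unpickle n)).

Let value (y q : R) : \bar R := (q * y)%:E - phi (q + 1)%R.

(* An approximate maximizer of [x * y - phi (x + 1)], taken among 0 and the
   first [n] rationals so as to depend measurably on [y]. *)
Fixpoint approx_argmax (n : nat) (y : R) : R :=
  if n is m.+1 then
    if value y (approx_argmax m y) < value y (rational m) then rational m
    else approx_argmax m y
  else 0%R.

Definition approx_conjugate n y : \bar R :=
  (approx_argmax n y * y)%:E - phi (approx_argmax n y + 1)%R.

Lemma approx_conjugate_nd y :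
  {homo approx_conjugate^~ y : n m / (n <= m)%N >-> n <= m}.
Proof.
apply/nondecreasing_seqP => n; rewrite /approx_conjugate /=.
by case: ifPn => // /ltW.
Qed.

Let approx_conjugate_rational n y :
  value y (rational n) <= approx_conjugate n.+1 y.
Proof. by rewrite /approx_conjugate /=; case: ifPn => //; rewrite -leNgt. Qed.

Lemma approx_conjugate_ge0 n y : 0 <= approx_conjugate n y.
Proof.
apply: le_trans (approx_conjugate_nd _ (leq0n n)).
by rewrite /approx_conjugate /= mul0r (add0r (1%R : R)) (divgen_at1 hphi) sube0.
Qed.

(** The search starts from the candidate 0, of value 0, and only improves, so it never selects a
    point where [phi] is infinite. *)
Lemma phi_approx_argmax_fin n y : phi (approx_argmax n y + 1)%R \is a fin_num.
Proof.
rewrite ge0_fin_numE ?(divgen_ge0 hphi)// ltey.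
by apply/eqP => E; have := approx_conjugate_ge0 n y; rewrite /approx_conjugate E.
Qed.

Lemma approx_argmax_ge n y : (0 <= approx_argmax n y + 1)%R.
Proof.
rewrite leNgt; apply/negP => /(divgen_neg hphi) E.
by have := phi_approx_argmax_fin n y; rewrite E.
Qed.

Lemma approx_argmax_bounded n :
  exists B : R, forall y, (`|approx_argmax n y| <= B)%R.
Proof.
elim: n => [|n [B IH]]; first by exists 0%R => y; rewrite normr0.
exists (Num.max B `|rational n|)%R => y /=.
by rewrite le_max; case: ifPn => _; rewrite ?lexx ?orbT// IH.
Qed.

Let measurable_value (f : R -> R) : measurable_fun setT f ->
  measurable_fun setT (fun y => value y (f y)).
Proof.
move=> mf; apply: emeasurable_funB.
  by apply/measurable_EFinP; exact: measurable_funM.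
apply: (measurableT_comp divergence_generator_measurable).
exact: measurable_funD.
Qed.

Lemma measurable_approx_argmax n : measurable_fun setT (approx_argmax n).
Proof.
elim: n => [|n IH]; first exact: measurable_cst.
apply: measurable_fun_ifT => //.
by apply: measurable_fun_lte; exact: measurable_value.
Qed.

Lemma measurable_approx_conjugate n : measurable_fun setT (approx_conjugate n).
Proof. exact: (measurable_value (@measurable_approx_argmax n)). Qed.

(** Since [phi] may jump to [+oo] at the end of its domain, a competitor [x] is shrunk to a rational
    [(1 - s) x]; convexity and [phi 1 = 0] give [phi ((1 - s) x + 1) <= (1 - s) phi (x + 1)]. *)
Lemma approx_conjugate_cvg y :
  approx_conjugate n y @[n --> \oo] --> conjugate (shift1 phi) y.
Proof.
have := ereal_nondecreasing_cvgn (@approx_conjugate_nd y).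
rewrite (_ : ereal_sup _ = conjugate (shift1 phi) y)//.
apply/eqP; rewrite eq_le; apply/andP; split.
  apply: ge_ereal_sup => _ [n _ <-]; exact: conjugate_shift_ub.
apply: ge_ereal_sup => _ [x _ <-]; rewrite /shift1.
have ub0 : 0 <= ereal_sup (range (approx_conjugate^~ y)).
  by apply: (le_trans (approx_conjugate_ge0 0 y)); apply: ereal_sup_ubound; exists 0%N.
case phix : (phi (x + 1)%R) => [a||]; [|by rewrite addeNy leNye
  |by have := divgen_ge0 hphi (x + 1)%R; rewrite phix].
have a0 : (0 <= a)%R by have := divgen_ge0 hphi (x + 1)%R; rewrite phix lee_fin.
have [x0|x0] := eqVneq x 0%R.
  apply: le_trans ub0; rewrite x0 mul0r lee_fin; rlra.
rewrite -EFinB; apply/lee_addgt0Pr => e e0; rewrite -leeBlDr// -EFinB.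
(* Any [s] below [s0] keeps the loss, at most [s |x y|], within [e]. *)
pose s0 := (Num.min 1 (e / (`|x * y| + 1)))%R.
have xy1 : (0 < `|x * y| + 1)%R by rewrite ltr_wpDl.
have s00 : (0 < s0)%R by rewrite lt_min ltr01 divr_gt0.
have s01 : (s0 <= 1)%R by rewrite ge_min lexx.
have [s [s_gt0 ss0 [q qE]]] : exists s : R, [/\ (0 < s)%R, (s < s0)%R &
    exists q : rat, (ratr q = (1 - s) * x)%R].
  have : ((1 - s0) * x < x)%R \/ (x < (1 - s0) * x)%R.
    by have [?|?|xE] := ltgtP x 0%R; [right; rnra|left; rnra|rewrite xE eqxx in x0].
  have sE (q : rat) : ((1 - (1 - ratr q / x)) * x = ratr q)%R by field.
  move=> [|] /rat_in_itvoo [q]; rewrite in_itv/= => /andP[q1 q2];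
    exists (1 - ratr q / x)%R; (have E := sE q; split;
      [| |by exists q; rewrite E]);
    set s := (1 - ratr q / x)%R in E *; rewrite -E in q1 q2.
  - have x_gt0 : (0 < x)%R by rnra. by rnra.
  - have x_gt0 : (0 < x)%R by rnra. by rnra.
  - have x_lt0 : (x < 0)%R by rnra. by rnra.
  - have x_lt0 : (x < 0)%R by rnra. by rnra.
apply: (@le_trans _ _ (value y (ratr q))); last first.
  apply: (@le_trans _ _ (approx_conjugate (pickle q).+1 y)).
    by have := approx_conjugate_rational (pickle q) y; rewrite /rational pickleK.
  by apply: ereal_sup_ubound; exists (pickle q).+1.
have := @ereal_convex_on_comb _ _ _ 1 (x + 1)%R 0 a s (divgen_convex hphi) I I.
rewrite (divgen_at1 hphi) phix => /(_ (lexx _) (lexx _)).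
rewrite (ltW s_gt0) (le_trans (ltW ss0) s01) => /(_ isT).
have -> : (s * 1 + (1 - s) * (x + 1))%R = (ratr q + 1)%R by rewrite qE; ring.
move=> H; rewrite /value.
apply: (@le_trans _ _ ((ratr q * y)%:E - (s * 0 + (1 - s) * a)%:E)); last first.
  by rewrite leeB.
rewrite -EFinB lee_fin qE.
have : (s * (`|x * y| + 1) <= e)%R.
  by rewrite -ler_pdivlMr// (le_trans (ltW ss0))// ge_min lexx orbT.
have := ler_norm (x * y)%R; rnra.
Qed.

Lemma measurable_conjugate_shift : measurable_fun setT (conjugate (shift1 phi)).
Proof.
apply: (@emeasurable_fun_cvg _ _ _ setT approx_conjugate) => [n|y _].
  exact: measurable_approx_conjugate.
exact: approx_conjugate_cvg.
Qed.

End divergence_generators.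

(** * Mixtures and densities of probability measures *)

Section probability_constructions.
Context {d : measure_display} {T : measurableType d} {R : realType}.

Lemma charge_ext (m1 m2 : {charge set T -> \bar R}) :
  (forall A, m1 A = m2 A) -> m1 = m2.
Proof.
case: m1 m2 => [f [[a] [b] [c]]] [g [[a'] [b'] [c']]] /= /funext fg.
move: a b c a' b' c'; rewrite fg => *.
by do ![f_equal; try exact: Prop_irrelevance].
Qed.

Lemma probability_mixture (mu nu : probability T R) (s : R) : (0 <= s <= 1)%R ->
  exists rho : probability T R,
    forall A, rho A = (1 - s)%:E * nu A + s%:E * mu A.
Proof.
move=> /andP[s0 s1].
have t0 : (0 <= 1 - s)%R by rewrite subr_ge0.
pose m : {measure set T -> \bar R} :=
  measure_add (mscale (NngNum t0) nu) (mscale (NngNum s0) mu).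
have mE A : m A = (1 - s)%:E * nu A + s%:E * mu A by exact: measure_addE.
have m1 : m setT = 1 by rewrite mE !probability_setT !mule1 -EFinD subrK.
exists (HB.pack_for (probability T R) (Measure.sort m)
  (Measure_isProbability.Build _ _ _ m m1)).
exact: mE.
Qed.

Lemma probability_density (nu : probability T R) (f : T -> R) :
  measurable_fun setT f -> (forall x, 0 <= f x)%R -> \int[nu]_x (f x)%:E = 1 ->
  exists mu : probability T R, forall A, mu A = \int[nu]_(x in A) (f x)%:E.
Proof.
move=> mf f0 f1; pose m A := \int[nu]_(x in A) (f x)%:E.
have m0 : m set0 = 0 by rewrite /m integral_set0.
have m_ge0 A : 0 <= m A by apply: integral_ge0 => x _; rewrite lee_fin.
have m_add : semi_sigma_additive m.
  by apply: semi_sigma_additive_nng_induced; [exact/measurable_EFinP|].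
pose M : {measure set T -> \bar R} := HB.pack_for {measure set T -> \bar R} m
  (isMeasure.Build _ _ _ m m0 m_ge0 m_add).
by exists (HB.pack_for (probability T R) (Measure.sort M)
  (Measure_isProbability.Build _ _ _ M f1)).
Qed.

Lemma integral_mixture (mu nu rho : probability T R) (s : R) (f : T -> \bar R) :
  (0 <= s <= 1)%R -> measurable_fun setT f -> (forall x, 0 <= f x) ->
  (forall A, measurable A -> rho A = (1 - s)%:E * nu A + s%:E * mu A) ->
  \int[rho]_x f x = (1 - s)%:E * \int[nu]_x f x + s%:E * \int[mu]_x f x.
Proof.
move=> /andP[s0 s1] mf f0 rhoE.
have t0 : (0 <= 1 - s)%R by rewrite subr_ge0.
pose m : {measure set T -> \bar R} :=
  measure_add (mscale (NngNum t0) nu) (mscale (NngNum s0) mu).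
have mE A : m A = (1 - s)%:E * nu A + s%:E * mu A by exact: measure_addE.
rewrite (eq_measure_integral m); last by move=> A mA _; rewrite mE; exact: rhoE.
by rewrite ge0_integral_measure_add// !ge0_integral_mscale.
Qed.

End probability_constructions.

(** * The divergence between probability measures in explicit form *)

Section divergence_of_probabilities.
Context {d : measure_display} {T : measurableType d} {R : realType}.
Implicit Types mu nu : probability T R.

(** On a measurable part of the negative Hahn set the charge is both nonnegative and nonpositive,
    hence zero. *)
Lemma nonneg_charge_jordan (sg : {charge set T -> \bar R}) (A : set T) :
  (forall A, measurable A -> 0 <= sg A) -> measurable A ->
  pos_part sg A = sg A /\ neg_part sg A = 0.
Proof.
move=> sg0 mA; have [[mP _] [mN negN] PN PN0] := hahnP sg.
have mAN : measurable (A `&` hahn_neg sg) by exact: measurableI.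
have nE : neg_part sg A = 0.
  transitivity (- crestr0 sg mN A); first exact: cjordan_negE.
  rewrite /crestr0 mem_set// /crestr; apply/eqP; rewrite oppe_eq0 eq_le sg0//.
  by rewrite negN//; exact: subIsetr.
split => //; have := jordan_decomp (hahnP sg) mA.
move=> ->; have -> : cadd (jordan_pos (hahnP sg)) (cscale (-1) (jordan_neg (hahnP sg)))
    A = pos_part sg A - neg_part sg A by rewrite /cadd /= cscaleN1.
by rewrite nE sube0.
Qed.

Lemma integrable_variation mu (f : T -> \bar R) :
  (Defs.variation (charge_of_finite_measure mu)).-integrable setT f ->
  mu.-integrable setT f.
Proof.
move=> /integrableP[mf intf]; apply/integrableP; split => //.
rewrite (eq_measure_integral (Defs.variation (charge_of_finite_measure mu)))// => A mA _.
have [posE negE] := @nonneg_charge_jordan (charge_of_finite_measure mu) A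
  (fun B _ => measure_ge0 mu B) mA.
apply/esym; transitivity (pos_part (charge_of_finite_measure mu) A
  + neg_part (charge_of_finite_measure mu) A); first by [].
by rewrite posE negE adde0.
Qed.

Variable phi : R -> \bar R.
Hypothesis hphi : divergence_generator phi.

(** Replaces the choices hidden in the definition by explicit data: [N] carries the singular part,
    and [f] is the density of [mu] off [N], in a version that is nonnegative and finite everywhere.
    The term with the slope at [-oo] vanishes because the singular part is nonnegative. *)
Lemma prob_divergence_decomposition mu nu : exists (N : set T) (f : T -> R),
  [/\ measurable N /\ nu N = 0,
      measurable_fun setT f /\ (forall x, 0 <= f x)%R,
      (forall A, measurable A ->
         mu (A `&` ~` N) = \int[nu]_(x in A) (f x)%:E),
      (forall h : T -> R, mu.-integrable setT (EFin \o h) ->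
         nu.-integrable setT (fun x => (h x * f x)%:E) /\
         \int[nu]_x (h x * f x)%:E = \int[mu]_(x in ~` N) (h x)%:E) &
      prob_divergence phi mu nu =
        \int[nu]_x phi (f x) + mu N * slope_pinfty phi].
Proof.
rewrite /prob_divergence /divergence /lebesgue_ac /lebesgue_sing.
case: cid => -[ac sg] /= [muE /= ac_nu [N [mN nuN sgN]]].
have mCN : measurable (~` N) by exact: measurableC.
have /null_content_dominatesP ac0 := ac_nu.
have acN A : measurable A -> A `<=` N -> ac A = 0.
  move=> mA AN; apply: ac0 => //.
  by apply/eqP; rewrite eq_le measure_ge0 andbT -nuN le_measure// inE.
have sgCN A : measurable A -> A `<=` ~` N -> sg A = 0.
  move=> mA AN; apply/eqP; rewrite -abse_eq0 eq_le abse_ge0 andbT.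
  apply: (le_trans (abse_charge_variation (hahnP sg) mA)).
  by rewrite -sgN; apply: le_measure; rewrite ?inE.
(* [ac] vanishes inside [N] and [sg] outside, so they are the restrictions of [mu] to the complement
   of [N] and to [N]. *)
have acE A : measurable A -> ac A = mu (A `&` ~` N).
  move=> mA; rewrite [RHS]muE; last exact: measurableI.
  rewrite sgCN ?adde0; [|exact: measurableI|exact: subIsetr].
  rewrite -[in LHS](setIT A) -(setUv N) setIUr chargeU; [|exact: measurableI..|].
    by rewrite acN ?add0e//; exact: measurableI.
  by rewrite setIACA setICr setI0.
have sgE A : measurable A -> sg A = mu (A `&` N).
  move=> mA; rewrite [RHS]muE; last exact: measurableI.
  rewrite acN ?add0e; [|exact: measurableI|exact: subIsetr].
  rewrite -[in LHS](setIT A) -(setUv N) setIUr chargeU; [|exact: measurableI..|].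
    by rewrite (sgCN (A `&` ~` N)) ?adde0//; exact: measurableI.
  by rewrite setIACA setICr setI0.
have [-> ->] : pos_part sg setT = sg setT /\ neg_part sg setT = 0.
  by apply: nonneg_charge_jordan => // A mA; rewrite sgE.
have muCNoo : mu (~` N) < +oo.
  by rewrite (le_lt_trans (probability_le1 _ _))// ltry.
pose m1 : {finite_measure set T -> \bar R} := mfrestr mCN muCNoo.
have m1E A : m1 A = mu (A `&` ~` N) by [].
have m1N : m1 N = 0 by rewrite m1E setICr measure0.
have m1_nu : m1 `<< nu.
  apply/null_content_dominatesP => A mA nuA; rewrite m1E -acE//.
  exact: ac0.
pose F := Radon_Nikodym_SigmaFinite.f m1 nu.
have F0 := Radon_Nikodym_SigmaFinite.f_ge0 m1_nu : forall x, 0 <= F x.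
have Ffin := Radon_Nikodym_SigmaFinite.f_fin_num m1_nu : forall x, F x \is a fin_num.
have Fint := Radon_Nikodym_SigmaFinite.f_integrable m1_nu : nu.-integrable setT F.
have mF : measurable_fun setT F by exact: measurable_int Fint.
pose f := fine \o F.
have fE x : (f x)%:E = F x by rewrite /f/= fineK.
have mf : measurable_fun setT f.
  apply/measurable_EFinP; rewrite (_ : EFin \o f = F)//; exact/funext.
have f0 x : (0 <= f x)%R by rewrite -lee_fin fE.
exists N, f; split => //.
- move=> A mA; under eq_integral do rewrite fE.
  by rewrite -(Radon_Nikodym_SigmaFinite.f_integral m1_nu).
- move=> h inth.
  have mh : measurable_fun setT h by apply/measurable_EFinP; exact: measurable_int inth.
  have m1h (k : T -> \bar R) : measurable_fun setT k ->
      \int[m1]_x k x = \int[mu]_(x in ~` N) k x.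
    move=> mk; rewrite -(setUv N) integral_setU ?setUv//; last first.
      by apply/disj_set2P; rewrite setICr.
    rewrite (null_set_integral mN) ?add0e//; last exact: measurable_funTS.
    apply: eq_measure_integral => A mA AN.
    by rewrite -[RHS]/(mu A) -[in RHS](setIidl AN).
  have int1 : m1.-integrable setT (EFin \o h).
    apply/integrableP; split; first exact/measurable_EFinP.
    rewrite m1h; last by apply: measurableT_comp => //; exact/measurable_EFinP.
    have /integrableP[_ ] := integrableS measurableT mCN (@subsetT _ _) inth.
    by [].
  split.
    apply/integrableP; split.
      by apply/measurable_EFinP; exact: measurable_funM.
    have /integrableP[_] := int1.
    rewrite -(Radon_Nikodym_SigmaFinite.change_of_variables m1_nu)//; last first.
      by apply: measurableT_comp => //; exact/measurable_EFinP.
    congr (_ < _); apply: eq_integral => x _.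
    by rewrite -/F -fE /= -EFinM normrM (ger0_norm (f0 x)).
  rewrite -(m1h (EFin \o h))//; last exact/measurable_EFinP.
  rewrite -(Radon_Nikodym_change_of_variables m1_nu)//.
  apply: ae_eq_integral => //.
  + by apply/measurable_EFinP; exact: measurable_funM.
  + apply: emeasurable_funM; first exact/measurable_EFinP.
    by apply: (measurable_int nu); exact: Radon_Nikodym_integrable.
  + have -> : (fun x => (h x * f x)%:E) = (EFin \o h) \* F.
      by apply/funext => x; rewrite /= EFinM fE.
    exact/ae_eqe_mul2l/ae_eq_Radon_Nikodym_SigmaFinite.
- rewrite sgE// setTI mul0e sube0; congr (_ + _).
  have mac : measurable_fun setT (radon_nikodym ac nu).
    by rewrite /radon_nikodym; apply: measurableT_comp.
  have mphi := divergence_generator_measurable hphi.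
  apply: ge0_ae_eq_integral => //; [exact: measurableT_comp..| | |].
  + by move=> x _; exact: divgen_ge0 hphi _.
  + by move=> x _; exact: divgen_ge0 hphi _.
  (* The chosen derivative and [f] have equal integrals over measurable sets, hence agree almost
     everywhere. *)
  apply: (ae_eq_comp phi); rewrite /radon_nikodym; apply: (ae_eq_comp fine).
  apply: integral_ae_eq => //; first exact: Radon_Nikodym_integrable.
  move=> E _ mE; rewrite -Radon_Nikodym_integral// acE//.
  by rewrite -(Radon_Nikodym_SigmaFinite.f_integral m1_nu).
Qed.

(** Absolute continuity gives [mu N = 0], which removes the singular term, and the given density
    agrees [nu]-almost everywhere with that of the decomposition. *)
Lemma prob_divergence_density mu nu (f : T -> R) : measurable_fun setT f ->
  nu.-integrable setT (EFin \o f) ->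
  (forall A, measurable A -> mu A = \int[nu]_(x in A) (f x)%:E) ->
  prob_divergence phi mu nu = \int[nu]_x phi (f x) /\
  forall h : T -> R, mu.-integrable setT (EFin \o h) ->
    \int[mu]_x (h x)%:E = \int[nu]_x (h x * f x)%:E.
Proof.
move=> mf intf muE.
have [N [g [[mN nuN] [mg g0] gE ghE ->]]] := prob_divergence_decomposition mu nu.
have mCN : measurable (~` N) by exact: measurableC.
have mphi := divergence_generator_measurable hphi.
have null A : measurable A -> nu A = 0 -> mu A = 0.
  move=> mA nuA; rewrite muE//; apply: null_set_integral => //.
  by apply/measurable_funTS/measurable_EFinP.
have /ae_eq_sym gf : ae_eq nu setT (EFin \o f) (EFin \o g).
  apply: integral_ae_eq => //; first exact/measurable_EFinP.
  move=> E _ mE; rewrite -muE// -gE//.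
  have -> : mu E = mu (E `&` N) + mu (E `&` ~` N).
    rewrite -[in LHS](setIT E) -(setUv N) setIUr.
    apply: measureU; [exact: measurableI..|].
    by rewrite setIACA setICr setI0.
  rewrite (null (E `&` N)) ?add0e//; first exact: measurableI.
  apply/eqP; rewrite eq_le measure_ge0 andbT -nuN le_measure// inE//.
  exact: measurableI.
split=> [|h inth].
  rewrite (null N)// mul0e adde0.
  apply: ge0_ae_eq_integral => //; [exact: measurableT_comp..| | |].
  - by move=> x _; exact: divgen_ge0 hphi _.
  - by move=> x _; exact: divgen_ge0 hphi _.
  - exact: (ae_eq_comp (phi \o fine)) gf.
have [hg_int hgE] := ghE _ inth.
have mh : measurable_fun setT h by apply/measurable_EFinP; exact: measurable_int inth.
transitivity (\int[mu]_(x in ~` N) (h x)%:E).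
  rewrite -(setUv N) integral_setU ?setUv//; last 2 first.
    exact/measurable_EFinP.
    by apply/disj_set2P; rewrite setICr.
  rewrite (null_set_integral mN) ?add0e//; last exact: null.
  exact/measurable_funTS/measurable_EFinP.
rewrite -hgE; apply: ae_eq_integral => //; first exact: measurable_int hg_int.
  by apply/measurable_EFinP; exact: measurable_funM.
by apply: (ae_eq_comp2 (fun x y => (h x * fine y)%:E)) gf.
Qed.

Lemma prob_divergence_ge0 mu nu : 0 <= prob_divergence phi mu nu.
Proof.
have [N [g [_ _ _ _ ->]]] := prob_divergence_decomposition mu nu.
rewrite adde_ge0 ?mule_ge0 ?slope_pinfty_ge0//.
by apply: integral_ge0 => x _; exact: divgen_ge0 hphi _.
Qed.

Lemma prob_divergence_refl nu : prob_divergence phi nu nu = 0.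
Proof.
rewrite (proj1 (@prob_divergence_density _ _ (cst 1%R) _ _ _))//.
- by rewrite integral0_eq// => x _; rewrite /= (divgen_at1 hphi).
- exact: finite_measure_integrable_cst.
- by move=> A mA; rewrite (integral_cst _ mA 1) mul1e.
Qed.

End divergence_of_probabilities.

(** * Comparison and integrability of integrands *)

Section integral_facts.
Context {d : measure_display} {T : measurableType d} {R : realType}.
Implicit Types (mu : {measure set T -> \bar R}).

Lemma integral_le_funepos mu (D : set T) (f : T -> \bar R) : measurable D ->
  mu.-integrable D f -> \int[mu]_(x in D) f x <= \int[mu]_(x in D) f^\+ x.
Proof.
move=> mD intf; by rewrite integralE -[leRHS]sube0 leeB// integral_ge0.
Qed.

(** Here [b] may be infinite or non-integrable, so the comparison passes through the positive part
    of [a]. *)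
Lemma integral_le_ge0 mu (a : T -> R) (b : T -> \bar R) :
  mu.-integrable setT (EFin \o a) -> measurable_fun setT b ->
  (forall x, 0 <= b x) -> (forall x, (a x)%:E <= b x) ->
  \int[mu]_x (a x)%:E <= \int[mu]_x b x.
Proof.
move=> inta mb b0 ab; apply: le_trans (integral_le_funepos measurableT inta) _.
apply: ge0_le_integral => //.
  by apply: measurable_funepos; exact: measurable_int inta.
by move=> x _; rewrite funeposE ge_max ab b0.
Qed.

Lemma integral_lincomb mu (u v : T -> R) (a b s t : R) :
  mu.-integrable setT (EFin \o u) -> mu.-integrable setT (EFin \o v) ->
  \int[mu]_x (u x)%:E = a%:E -> \int[mu]_x (v x)%:E = b%:E ->
  \int[mu]_x (s * u x + t * v x)%:E = (s * a + t * b)%:E.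
Proof.
move=> iu iv ua vb.
under eq_integral do rewrite EFinD !EFinM.
rewrite integralD//; [|exact: integrableZl..].
by rewrite !integralZl// ua vb.
Qed.

Lemma integrable_mul_bounded mu (h f : T -> R) (B : R) :
  mu.-integrable setT (EFin \o h) -> measurable_fun setT f ->
  (forall x, `|f x| <= B)%R -> mu.-integrable setT (EFin \o (h \* f)%R).
Proof.
move=> inth mf fB.
apply: (@eq_integrable _ _ _ _ _ measurableT ((EFin \o h) \* (EFin \o f))) => //.
apply: integrableMl => //.
exists B; split; first exact: num_real.
by move=> y By x _ /=; exact: le_trans (ltW By).
Qed.

End integral_facts.

(** * One-dimensional separation by a multiplier *)

Section convex_multiplier.
Context {R : realType}.

(** The third hypothesis says that a segment from a point right of the vertical axis to one left of
    it meets the axis at height at most [S]. So slopes from [(0, S)] to the right never exceed those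
    to the left, and [- lam] is the supremum of the former. *)
Lemma lagrange_multiplier (Q : set (R * R)) (S : R) :
  (exists2 p, Q p & (0 < p.1)%R) -> (exists2 p, Q p & (p.1 < 0)%R) ->
  (forall p q, Q p -> Q q -> (0 < p.1)%R -> (q.1 < 0)%R ->
     (- q.1 * (p.2 - S) + p.1 * (q.2 - S) <= 0)%R) ->
  (forall p, Q p -> p.1 = 0%R -> (p.2 <= S)%R) ->
  exists lam : R, forall p, Q p -> (p.2 + lam * p.1 <= S)%R.
Proof.
move=> [p0 Qp0 p00] [q0 Qq0 q00] cross zero.
pose E := [set k | exists2 p, Q p /\ (0 < p.1)%R & k = ((p.2 - S) / p.1)%R].
have Ep0 : E ((p0.2 - S) / p0.1)%R by exists p0.
have ubE q : Q q -> (q.1 < 0)%R -> ubound E ((S - q.2) / (- q.1))%R.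
  move=> Qq q1 _ [p [Qp p1] ->].
  rewrite ler_pdivrMr// mulrAC ler_pdivlMr ?oppr_gt0//.
  by have := cross _ _ Qp Qq p1 q1; rlra.
have supE : has_ubound E by exists ((S - q0.2) / (- q0.1))%R; exact: ubE.
exists (- sup E)%R => p Qp.
have [p1|p1|p1] := ltgtP p.1 0%R; last by rewrite p1 mulr0 addr0 zero.
  have : (sup E <= (S - p.2) / (- p.1))%R.
    by apply: ge_sup; [exists ((p0.2 - S) / p0.1)%R|exact: ubE].
  by rewrite ler_pdivlMr ?oppr_gt0//; rlra.
have : ((p.2 - S) / p.1 <= sup E)%R by apply: ub_le_sup => //; exists p.
by rewrite ler_pdivrMr//; rlra.
Qed.

End convex_multiplier.

(** * Weak duality *)

Section duality.
Context {d : measure_display} {T : measurableType d} {R : realType}.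
Implicit Types (mu nu : probability T R) (g h : T -> R).
Variable phi : R -> \bar R.
Hypothesis hphi : divergence_generator phi.

Let mpsi := measurable_conjugate_shift hphi.
Let mphi := divergence_generator_measurable hphi.

Lemma measurable_conjugate_comp h : measurable_fun setT h ->
  measurable_fun setT (fun x => conjugate (shift1 phi) (h x)).
Proof. by move=> mh; exact: measurableT_comp. Qed.

Lemma mean_gap_fin_num g mu nu : mu.-integrable setT (EFin \o g) ->
  nu.-integrable setT (EFin \o g) -> mean_gap g mu nu \is a fin_num.
Proof.
by move=> mug nug; rewrite /mean_gap fin_numB !integrable_fin_num.
Qed.

Lemma integral_affine mu g (t lam : R) : mu.-integrable setT (EFin \o g) ->
  mu.-integrable setT (EFin \o (fun x => t * g x + lam)%R) /\
  \int[mu]_x (t * g x + lam)%:E = t%:E * \int[mu]_x (g x)%:E + lam%:E.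
Proof.
move=> ig; have ic : mu.-integrable setT (EFin \o cst lam).
  exact: finite_measure_integrable_cst.
have itg : mu.-integrable setT (fun x => t%:E * (g x)%:E) by exact: integrableZl.
have E : EFin \o (fun x => t * g x + lam)%R =
    (fun x => t%:E * (g x)%:E) \+ (EFin \o cst lam).
  by apply/funext => x; rewrite /= EFinD EFinM.
split; first by rewrite E; exact: integrableD.
rewrite (eq_integral ((fun x => t%:E * (g x)%:E) \+ (EFin \o cst lam))); last first.
  by move=> x _; rewrite /= EFinD EFinM.
rewrite integralD// integralZl//; congr (_ + _).
have -> : lam%:E = lam%:E * mu setT by rewrite probability_setT mule1.
exact: (integral_cst mu measurableT lam%:E).
Qed.

(** With [h = t g + lam], the gap splits into the [mu]-integral of [h] over [N] and the
    [nu]-integral of [h (f - 1)]. Young's inequality bounds the second; the finite [mu]-integral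
    keeps [h] below the slope of [phi] almost everywhere and so bounds the first. *)
Lemma mean_gap_le_conjugate_divergence mu nu g (t lam : R) :
  mu.-integrable setT (EFin \o g) -> nu.-integrable setT (EFin \o g) ->
  \int[mu]_x conjugate (shift1 phi) (t * g x + lam)%R < +oo ->
  t%:E * mean_gap g mu nu <=
    \int[nu]_x conjugate (shift1 phi) (t * g x + lam)%R
    + prob_divergence phi mu nu.
Proof.
move=> mug nug psi_mu; set h := fun x => (t * g x + lam)%R.
have [imuh muhE] := integral_affine t lam mug.
have [inuh nuhE] := integral_affine t lam nug.
rewrite -/h in imuh inuh muhE nuhE.
have mh : measurable_fun setT h by apply/measurable_EFinP; exact: measurable_int imuh.
have mpsih := measurable_conjugate_comp mh.
have psi0 x : 0 <= conjugate (shift1 phi) (h x) by exact: conjugate_shift_ge0.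
have [N [f [[mN nuN] [mf f0] fE hE ->]]] := prob_divergence_decomposition hphi mu nu.
have [ihf hfE] := hE _ imuh.
have mCN : measurable (~` N) by exact: measurableC.
have muh_fin := integrable_fin_num measurableT imuh.
have nuh_fin := integrable_fin_num measurableT inuh.
have hf_fin := integrable_fin_num measurableT ihf.
have imuhN : mu.-integrable N (EFin \o h) by exact: integrableS imuh.
have muhN_fin := integrable_fin_num mN imuhN.
have muhE2 : \int[mu]_x (h x)%:E =
    \int[mu]_(x in N) (h x)%:E + \int[nu]_x (h x * f x)%:E.
  rewrite hfE -[in LHS](setUv N) integral_setU ?setUv//.
    exact/measurable_EFinP.
  by apply/disj_set2P; rewrite setICr.
(* The constant [lam] cancels because both measures have total mass one. *)
have gapE : t%:E * mean_gap g mu nu =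
    \int[mu]_(x in N) (h x)%:E + \int[nu]_x (h x * f x - h x)%:E.
  have -> : \int[nu]_x (h x * f x - h x)%:E =
      \int[nu]_x (h x * f x)%:E - \int[nu]_x (h x)%:E.
    by under eq_integral do rewrite EFinB; rewrite integralB.
  rewrite addeA -muhE2 muhE nuhE /mean_gap.
  have /fineK <- := integrable_fin_num measurableT mug.
  have /fineK <- := integrable_fin_num measurableT nug.
  set a := fine _; set b := fine _.
  have -> : t%:E * (a%:E - b%:E) = (t * a + lam - (t * b + lam))%:E.
    by rewrite -EFinB -EFinM; congr EFin; ring.
  by [].
have ihfh : nu.-integrable setT (EFin \o (fun x => h x * f x - h x)%R).
  apply: (@eq_integrable _ _ _ _ _ measurableT
    ((fun x => (h x * f x)%:E) \- (EFin \o h))) => //.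
  exact: integrableB.
have singular : \int[mu]_(x in N) (h x)%:E <= mu N * slope_pinfty phi.
  have sl0 := slope_pinfty_ge0 hphi.
  have [muN0|muN0] := eqVneq (mu N) 0.
    rewrite muN0 mul0e null_set_integral//.
    exact/measurable_funTS/measurable_EFinP.
  case slE : (slope_pinfty phi) => [sl||]; last by move: sl0; rewrite slE.
    have muNfin : mu N \is a fin_num by rewrite fin_num_measure.
    have icst : mu.-integrable N (EFin \o cst sl).
      exact: finite_measure_integrable_cst.
    rewrite -sube_le0 ?fin_numM//.
    have <- : \int[mu]_(x in N) ((h x)%:E - sl%:E) =
        \int[mu]_(x in N) (h x)%:E - mu N * sl%:E.
      rewrite (integralB mN imuhN icst) /=.
      by rewrite (integral_cst mu mN sl%:E) muleC.
    have isub : mu.-integrable N (fun x => (h x)%:E - sl%:E).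
      exact: (integrableB mN imuhN icst).
    apply: le_trans (integral_le_funepos mN isub) _.
    rewrite le_eqVlt; apply/orP; left; apply/eqP.
    (* The conjugate of [h] is finite [mu]-almost everywhere, so [h <= sl] there and the positive
       part of [h - sl] integrates to 0. *)
    rewrite -[RHS](integral0 mu N); apply: ge0_ae_eq_integral => //.
      by apply: measurable_funepos; exact: measurable_int isub.
    have ipsi : mu.-integrable setT (fun x => conjugate (shift1 phi) (h x)).
      apply/integrableP; split => //.
      by under eq_integral do rewrite gee0_abs//.
    apply: filterS (integrable_ae measurableT ipsi) => x /(_ I) psifin _.
    rewrite funeposE; apply/max_idPr; rewrite sube_le0// -slE.
    by apply: (conjugate_shift_lty_le hphi); rewrite ltey_eq psifin.
  by rewrite gt0_muley ?leey// lt0e muN0 measure_ge0.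
rewrite gapE addeC addeA leeD//.
rewrite -ge0_integralD//; last 3 first.
- by move=> x _; exact: psi0.
- by move=> x _; exact: divgen_ge0 hphi _.
- exact: measurableT_comp.
apply: integral_le_ge0 => //.
- by apply: emeasurable_funD => //; exact: measurableT_comp.
- by move=> x; apply: adde_ge0; [exact: psi0|exact: divgen_ge0 hphi _].
move=> x; have := conjugate_shift_ub phi (f x - 1) (h x); rewrite subrK.
case phif : (phi (f x)) => [r||].
- by rewrite leeBlDr//; apply: le_trans; rewrite lee_fin; rlra.
- by move=> _; rewrite addey ?leey// -ltNye (lt_le_trans _ (psi0 x)).
- by have := divgen_ge0 hphi (f x); rewrite phif.
Qed.

End duality.

(** * Strong duality over bounded densities *)

Section strong_duality.
Context {d : measure_display} {T : measurableType d} {R : realType}.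
Implicit Types (mu nu : probability T R) (g h : T -> R).
Variable phi : R -> \bar R.
Hypothesis hphi : divergence_generator phi.

Let mphi := divergence_generator_measurable hphi.

Lemma generator_convex_comb (s t x y : R) : (0 < s)%R -> (0 < t)%R ->
  (s + t = 1)%R -> phi (s * x + t * y)%R <= s%:E * phi x + t%:E * phi y.
Proof.
move=> s0 t0 st1; have phi0 := divgen_ge0 hphi.
case phix : (phi x) => [a||]; last by have := phi0 x; rewrite phix.
  case phiy : (phi y) => [b||]; last by have := phi0 y; rewrite phiy.
    have -> : t = (1 - s)%R by rlra.
    apply: (@ereal_convex_on_comb _ _ _ _ _ _ _ _ (divgen_convex hphi)) => //.
    + by rewrite phix.
    + by rewrite phiy.
    + by apply/andP; split; rlra.
  by rewrite gt0_muley ?lte_fin// -EFinM addey// leey.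
rewrite gt0_muley ?lte_fin// addye ?leey// -ltNye (@lt_le_trans _ _ 0)//.
by rewrite mule_ge0// lee_fin ltW.
Qed.

Lemma bounded_integrable nu (f : T -> R) (B : R) : measurable_fun setT f ->
  (forall x, `|f x| <= B)%R -> nu.-integrable setT (EFin \o f).
Proof.
move=> mf fB; apply: measurable_bounded_integrable => //.
  by apply: le_lt_trans (probability_le1 nu measurableT) _; rewrite ltry.
exists B; split; first exact: num_real.
by move=> y By x _ /=; exact: le_trans (ltW By).
Qed.

(* Lagrangian duality for the single constraint that the density has mean one:
   the value function of the maximization over bounded densities f of
   int h (f - 1) - int phi f, as a function of the mean of f - 1, is concave
   and finite around 0, so it has a supergradient - lam there; maximizing
   the Lagrangian pointwise produces the conjugate. *)
Lemma lagrange_multiplier_density nu h (S : R) : nu.-integrable setT (EFin \o h) ->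
  (forall f : T -> R, measurable_fun setT f -> (forall x, 0 <= f x)%R ->
     (exists B : R, forall x, (f x <= B)%R) -> \int[nu]_x (f x)%:E = 1 ->
     \int[nu]_x (h x * (f x - 1))%:E - \int[nu]_x phi (f x) <= S%:E) ->
  exists lam : R,
    \int[nu]_x conjugate (shift1 phi) (h x + lam)%R <= S%:E.
Proof.
move=> inth HS.
have phi0 := divgen_ge0 hphi.
have mh : measurable_fun setT h by apply/measurable_EFinP; exact: measurable_int inth.
have bint (f : T -> R) : measurable_fun setT f -> (forall x, 0 <= f x)%R ->
    (exists B : R, forall x, (f x <= B)%R) ->
    nu.-integrable setT (EFin \o f) /\
    nu.-integrable setT (EFin \o (fun x => h x * (f x - 1))%R).
  move=> mf f0 [B fB]; split.
    by apply: (@bounded_integrable _ _ B) => // x; rewrite ger0_norm.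
  apply: (@integrable_mul_bounded _ _ _ _ _ (fun x => f x - 1)%R (B + 1)) => //.
    exact: measurable_funB.
  move=> x; rewrite (le_trans (ler_normB _ _))// normr1 lerD2r ger0_norm//.
(* The first coordinate is the mean of [f - 1], the second the objective at [f]; only [f] with
   finite [phi]-integral are kept. *)
pose Q := [set p : R * R | exists f : T -> R,
  [/\ measurable_fun setT f, (forall x, 0 <= f x)%R,
      (exists B : R, forall x, (f x <= B)%R),
      (exists2 q : R, \int[nu]_x phi (f x) = q%:E &
         \int[nu]_x (h x * (f x - 1))%:E = (p.2 + q)%:E) &
      \int[nu]_x (f x)%:E = (p.1 + 1)%:E]].
have icst (r : \bar R) : \int[nu]_x (cst r x) = r.
  transitivity (r * nu setT); last by rewrite probability_setT mule1.
  exact: integral_cst.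
have /fineK intE := integrable_fin_num measurableT inth.
have Qcst (r q : R) : phi r = q%:E -> exists2 p, Q p & p.1 = (r - 1)%R.
  move=> phir; pose m := fine (\int[nu]_x (h x)%:E).
  exists (r - 1, (r - 1) * m - q)%R => //; exists (cst r); split.
  - exact: measurable_cst.
  - by move=> x; rewrite leNgt; apply/negP => /(divgen_neg hphi); rewrite phir.
  - by exists r.
  - exists q; first by rewrite -phir; exact: (icst (phi r)).
    rewrite subrK EFinM intE -integralZl//.
    by apply: eq_integral => x _; rewrite EFinM muleC.
  - by rewrite subrK; exact: (icst r%:E).
have [e e0 phie] : exists2 e : R, (0 < e)%R &
    forall y, (`|1 - y| < e)%R -> phi y < +oo.
  by have /nbhs_ballP[e /= e0 He] := divgen_dom1 hphi; exists e => // y /He.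
have phifin y : (`|1 - y| < e)%R -> exists q, phi y = q%:E.
  by move=> /phie phiy; exists (fine (phi y)); rewrite fineK// ge0_fin_numE.
have [lam lamP] : exists lam : R, forall p, Q p -> (p.2 + lam * p.1 <= S)%R.
  apply: lagrange_multiplier.
  (* Constants slightly above and below 1 lie in the domain of [phi] and give points of [Q] on both
     sides. *)
  - have [|q /Qcst [p Qp p1]] := phifin (1 + e / 2)%R.
      by rewrite opprD addrA subrr sub0r normrN ger0_norm; rlra.
    by exists p => //; rewrite p1; rlra.
  - have [|q /Qcst [p Qp p1]] := phifin (1 - e / 2)%R.
      by rewrite opprB addrCA subrr addr0 ger0_norm; rlra.
    by exists p => //; rewrite p1; rlra.
  - move=> p q [f1 [mf1 f10 [B1 f1B] [a1 a1E b1E] c1E]]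
      [f2 [mf2 f20 [B2 f2B] [a2 a2E b2E] c2E]] p1 q1.
    have pq0 : (0 < p.1 - q.1)%R by rlra.
    have pqn0 : (p.1 - q.1 != 0)%R by rewrite gt_eqF.
    (* The weights for which the mixture of [f1] and [f2] has mean exactly one, so that [HS] applies
       to it. *)
    pose s := (- q.1 / (p.1 - q.1))%R; pose t := (p.1 / (p.1 - q.1))%R.
    have s0 : (0 < s)%R by rewrite divr_gt0// oppr_gt0.
    have t0 : (0 < t)%R by rewrite divr_gt0.
    have st1 : (s + t = 1)%R by rewrite /s /t; field.
    have stpq : (s * p.1 + t * q.1 = 0)%R by rewrite /s /t; field.
    pose f x := (s * f1 x + t * f2 x)%R.
    have mf : measurable_fun setT f.
      by apply: measurable_funD; exact: measurable_funM.
    have f0 x : (0 <= f x)%R by rewrite addr_ge0// mulr_ge0// ltW.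
    have fB : exists B : R, forall x, (f x <= B)%R.
      by exists (s * B1 + t * B2)%R => x; rewrite lerD// ler_wpM2l// ltW.
    have [if1 ihf1] := bint _ mf1 f10 (ex_intro _ B1 f1B).
    have [if2 ihf2] := bint _ mf2 f20 (ex_intro _ B2 f2B).
    have intf : \int[nu]_x (f x)%:E = 1.
      rewrite (integral_lincomb _ _ if1 if2 c1E c2E); congr EFin.
      by rewrite !mulrDr !mulr1 addrACA stpq st1 add0r.
    have inthf : \int[nu]_x (h x * (f x - 1))%:E =
        (s * (p.2 + a1) + t * (q.2 + a2))%:E.
      rewrite -(integral_lincomb s t ihf1 ihf2 b1E b2E).
      apply: eq_integral => x _; congr EFin.
      transitivity (h x * (s * f1 x + t * f2 x - (s + t)))%R; last by ring.
      by rewrite st1.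
    have intphi : \int[nu]_x phi (f x) <= (s * a1 + t * a2)%:E.
      rewrite EFinD !EFinM -a1E -a2E -!ge0_integralZl_EFin ?(ltW s0) ?(ltW t0)//;
        try by [move=> x _; exact: phi0|exact: measurableT_comp].
      rewrite -ge0_integralD//;
        try by [move=> x _; rewrite mule_ge0// lee_fin ltW
               |apply: measurable_funeM; exact: measurableT_comp].
      apply: ge0_le_integral => //.
      + exact: measurableT_comp.
      + by apply: emeasurable_funD; apply: measurable_funeM; exact: measurableT_comp.
      + by move=> x _; exact: generator_convex_comb.
    have : (s * (p.2 + a1) + t * (q.2 + a2) - (s * a1 + t * a2) <= S)%R.
      rewrite -lee_fin EFinB -inthf; apply: le_trans (HS f mf f0 fB intf).
      exact: leeB.
    have -> : (- q.1)%R = (s * (p.1 - q.1))%R by rewrite /s mulfVK.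
    have -> : (p.1 * (q.2 - S) = t * (p.1 - q.1) * (q.2 - S))%R.
      by rewrite /t mulfVK.
    have -> : (s * (p.2 + a1) + t * (q.2 + a2) - (s * a1 + t * a2) =
      s * (p.2 - S) + t * (q.2 - S) + (s + t) * S)%R by ring.
    rewrite st1 mul1r gerDr => H.
    rewrite (_ : _ + _ = (p.1 - q.1) * (s * (p.2 - S) + t * (q.2 - S)))%R; last by ring.
    by rewrite pmulr_rle0.
  - move=> p [f [mf f0 fB [a aE bE] cE]] p1.
    rewrite p1 add0r in cE.
    by have := HS f mf f0 fB cE; rewrite bE aE -EFinB addrK lee_fin.
exists lam; pose k x := (h x + lam)%R.
have mk : measurable_fun setT k by exact: measurable_funD.
have intk : nu.-integrable setT (EFin \o k).
  have := (integral_affine 1 lam inth).1.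
  by rewrite (_ : (fun x => 1 * h x + lam)%R = k)//; apply/funext => x; rewrite mul1r.
(* The approximate maximizer at [k x], plus one, is bounded and nonnegative, hence gives a point of
   [Q]; the multiplier inequality there is the claim. *)
have key n : \int[nu]_x approx_conjugate phi n (k x) <= S%:E.
  pose u x := approx_argmax phi n (k x).
  have mu_ : measurable_fun setT u.
    by apply: measurableT_comp => //; exact: measurable_approx_argmax.
  have [B uB] := approx_argmax_bounded phi n.
  have u1 x : (0 <= u x + 1)%R by exact: approx_argmax_ge.
  have uB' x : (`|u x| <= B)%R by exact: uB.
  have iu := bounded_integrable nu mu_ uB'.
  have ihu := integrable_mul_bounded inth mu_ uB'.
  have iku := integrable_mul_bounded intk mu_ uB'.
  have phifinu x : phi (u x + 1)%R \is a fin_num by exact: phi_approx_argmax_fin.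
  have mphiu : measurable_fun setT (fun x => phi (u x + 1)%R).
    by apply: measurableT_comp => //; exact: measurable_funD.
  (* Nonnegativity of [approx_conjugate] dominates [phi (u + 1)] by the integrable [k u]. *)
  have iphi : nu.-integrable setT (fun x => phi (u x + 1)%R).
    apply: le_integrable iku => // x _.
    have := approx_conjugate_ge0 hphi n (k x); rewrite /approx_conjugate -/(u x).
    rewrite sube_ge0 ?phifinu// => H; rewrite gee0_abs// (le_trans H)//.
    by rewrite /= lee_fin mulrC ler_norm.
  have /fineK qE := integrable_fin_num measurableT iphi.
  have /fineK uE := integrable_fin_num measurableT iu.
  have /fineK huE := integrable_fin_num measurableT ihu.
  set q := fine _ in qE; set c := fine _ in uE; set b := fine _ in huE.
  have kuE : \int[nu]_x (k x * u x)%:E = (b + lam * c)%:E.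
    rewrite -[b]mul1r -(integral_lincomb 1 lam ihu iu (esym huE) (esym uE)).
    by apply: eq_integral => x _; congr EFin; rewrite /k /=; ring.
  have -> : \int[nu]_x approx_conjugate phi n (k x) = (b + lam * c - q)%:E.
    rewrite EFinB -kuE qE -integralB//.
    by apply: eq_integral => x _; rewrite /approx_conjugate -/(u x) mulrC.
  have /lamP /= : Q (c, b - q)%R.
    exists (fun x => u x + 1)%R; split => //.
    - exact: measurable_funD.
    - exists (B + 1)%R => x; rewrite lerD2r.
      exact: le_trans (ler_norm _) (uB _).
    - exists q => //; rewrite subrK huE.
      by apply: eq_integral => x _; rewrite addrK.
    - have i1 : nu.-integrable setT (EFin \o cst 1%R).
        exact: finite_measure_integrable_cst.
      have := integral_lincomb 1 1 iu i1 (esym uE) (icst 1%:E).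
      by rewrite !mul1r => <-; apply: eq_integral => x _; rewrite !mul1r.
  by move=> H; rewrite lee_fin; rlra.
(* The approximants increase to the conjugate, so monotone convergence carries the bound over. *)
have mono : \int[nu]_x approx_conjugate phi n (k x) @[n --> \oo] -->
    \int[nu]_x conjugate (shift1 phi) (k x).
  rewrite (_ : \int[nu]_x conjugate _ (k x) =
    \int[nu]_x (fun x => limn (fun n => approx_conjugate phi n (k x))) x); last first.
    apply: eq_integral => x _; apply/esym/cvg_lim => //.
    exact: approx_conjugate_cvg.
  apply: (@cvg_monotone_convergence _ _ _ nu setT measurableT
    (fun n x => approx_conjugate phi n (k x))) => //.
  - by move=> n; apply: measurableT_comp => //; exact: measurable_approx_conjugate.
  - by move=> n x _; exact: approx_conjugate_ge0.
  - by move=> x _; exact: approx_conjugate_nd.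
rewrite -(cvg_lim _ mono)//; apply: lime_le; first by apply/cvg_ex; eexists; exact: mono.
by apply: nearW => n; exact: key.
Qed.

End strong_duality.

(** * The two inequalities between cumulant and divergence *)

Section cumulant_duality.
Context {d : measure_display} {T : measurableType d} {R : realType}.
Implicit Types (mu nu rho : probability T R) (g h : T -> R) (P : set (probability T R)).
Variable phi : R -> \bar R.
Hypothesis hphi : divergence_generator phi.

Definition mixture_closed P := forall mu nu rho (s : R), P mu -> P nu ->
  (0 < s < 1)%R -> (forall A, rho A = (1 - s)%:E * nu A + s%:E * mu A) -> P rho.

Definition bounded_density_closed P := forall mu nu (f : T -> R), P nu ->
  measurable_fun setT f -> (forall x, 0 <= f x)%R ->
  (exists B : R, forall x, (f x <= B)%R) ->
  (forall A, mu A = \int[nu]_(x in A) (f x)%:E) -> P mu.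

(* The constraint defining the cumulant only controls g almost everywhere for
   the base measure, so a component of mu singular to nu is handled by moving
   the base measure slightly towards mu. *)
Lemma mean_gap_divergence_le_cumulant P g t mu nu : mixture_closed P ->
  P mu -> P nu ->
  mu.-integrable setT (EFin \o g) -> nu.-integrable setT (EFin \o g) ->
  t%:E * mean_gap g mu nu - prob_divergence phi mu nu <=
    ereal_sup [set centered_cumulant phi g rho t | rho in P].
Proof.
move=> mixP Pmu Pnu mug nug; set S := ereal_sup _.
have := mean_gap_fin_num mug nug; case gapE : (mean_gap g mu nu) => [c||]// _.
rewrite -EFinM; set b := (t * c)%R.
have := prob_divergence_ge0 hphi mu nu.
case divE : (prob_divergence phi mu nu) => [D||]//; last by rewrite addeNy leNye.
rewrite lee_fin -EFinB => D0.
(* Moving the base measure by [s] costs a factor [1 - s] on [b]; the loss [s b] is made at most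
   [e]. *)
suff H s : (0 < s < 1)%R -> ((1 - s) * b - D)%:E <= S.
  apply/lee_addgt0Pr => e e0; rewrite -leeBlDr// -EFinB.
  have b1 : (0 < `|b| + 1)%R by rewrite ltr_wpDl.
  pose s := (Num.min (1 / 2) (e / (`|b| + 1)))%R.
  have s0 : (0 < s)%R by rewrite lt_min !divr_gt0.
  have s1 : (s < 1)%R by rewrite gt_min; apply/orP; left; rlra.
  apply: (le_trans _ (H s _)); last by rewrite s0.
  have : (s * (`|b| + 1) <= e)%R by rewrite -ler_pdivlMr// ge_min lexx orbT.
  have := ler_norm b; rewrite lee_fin; rnra.
move=> /[dup] s01 /andP[s0 s1].
have s01' : (0 <= s <= 1)%R by rewrite !ltW.
have [rho rhoE] := probability_mixture mu nu s01'.
apply: (@le_trans _ _ (centered_cumulant phi g rho t)); last first.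
  by apply: ereal_sup_ubound; exists rho => //; exact: mixP rhoE.
apply: le_ereal_inf_tmp => _ [lam _ <-].
have [ih _] := integral_affine t lam mug.
have mh : measurable_fun setT (fun x => t * g x + lam)%R.
  by apply/measurable_EFinP; exact: measurable_int ih.
have mpsi := measurable_conjugate_comp hphi mh.
have psi0 x : 0 <= conjugate (shift1 phi) (t * g x + lam)%R.
  exact: conjugate_shift_ge0.
rewrite (integral_mixture s01' mpsi psi0 (fun A _ => rhoE A)).
set A := \int[nu]_x _; set B := \int[mu]_x _.
have A0 : 0 <= A by apply: integral_ge0.
have B0 : 0 <= B by apply: integral_ge0.
have s1' : (0 < 1 - s)%R by rewrite subr_gt0.
(* If the [mu]-integral is infinite, so is the one for [rho]; otherwise weak duality applies to [mu]
   and [nu] with the same [lam]. *)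
have [Boo|Boo] := eqVneq B +oo.
  rewrite Boo gt0_muley ?lte_fin// addey ?leey//.
  by rewrite -ltNye (@lt_le_trans _ _ 0)// mule_ge0// lee_fin ltW.
have : t%:E * mean_gap g mu nu <= A + prob_divergence phi mu nu.
  by apply: (mean_gap_le_conjugate_divergence hphi mug nug); rewrite ltey.
rewrite gapE divE -EFinM -/b => bA.
apply: (@le_trans _ _ ((1 - s)%:E * A)); last first.
  by rewrite leeDl// mule_ge0// lee_fin ltW.
case AE : A bA A0 => [a||]//; last by move=> *; rewrite gt0_muley ?lte_fin// leey.
(* Since [D >= 0], [(1 - s) b - D <= (1 - s) (b - D) <= (1 - s) a]. *)
by rewrite -EFinD -EFinM !lee_fin => ? ?; rnra.
Qed.

(** The multiplier supplies a [lam] with integral at most [S]; it is feasible because a finite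
    integral keeps [t g + lam] below the slope of [phi] almost everywhere. *)
Lemma centered_cumulant_le P g nu t (S : \bar R) : bounded_density_closed P ->
  P nu -> (forall mu, P mu -> mu.-integrable setT (EFin \o g)) ->
  (forall mu, P mu -> t%:E * mean_gap g mu nu - prob_divergence phi mu nu <= S) ->
  centered_cumulant phi g nu t <= S.
Proof.
move=> densP Pnu intg HS.
have nug := intg _ Pnu.
have mg : measurable_fun setT g by apply/measurable_EFinP; exact: measurable_int nug.
(* The competitor [mu = nu] rules out [S = -oo]. *)
have S0 : 0 <= S.
  apply: le_trans (HS _ Pnu); rewrite (prob_divergence_refl hphi) sube0 /mean_gap.
  by rewrite subee ?mule0// integrable_fin_num.
case: S S0 HS => [S _ HS||]//; last by move=> *; rewrite leey.
have inth : nu.-integrable setT (EFin \o (fun x => t * g x)%R).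
  have := (integral_affine t 0 nug).1.
  by rewrite (_ : (fun x => t * g x + 0)%R = (fun x => t * g x)%R)//;
    apply/funext => x; rewrite addr0.
have [lam lamP] : exists lam : R,
    \int[nu]_x conjugate (shift1 phi) (t * g x + lam)%R <= S%:E.
  apply: (lagrange_multiplier_density hphi inth) => f mf f0 [B fB] f1.
  have [mu muE] := probability_density mf f0 f1.
  have Pmu : P mu by apply: (densP _ _ _ Pnu mf f0 _ muE); exists B.
  have fB' x : (`|f x| <= B)%R by rewrite ger0_norm.
  have intf := bounded_integrable nu mf fB'.
  have igf := integrable_mul_bounded nug mf fB'.
  have [divE chE] := prob_divergence_density hphi mf intf (fun A _ => muE A).
  have := HS _ Pmu; rewrite divE /mean_gap (chE _ (intg _ Pmu)).
  rewrite -integralB// -integralZl//; last exact: integrableB.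
  apply: le_trans; rewrite leeB// le_eqVlt; apply/orP; left; apply/eqP.
  apply: eq_integral => x _; rewrite -EFinB -EFinM; congr EFin; ring.
apply: (le_trans _ lamP); apply: ereal_inf_lbound; exists lam => //=.
have lamoo : \int[nu]_x conjugate (shift1 phi) (t * g x + lam)%R < +oo.
  exact: (le_lt_trans lamP (ltry _)).
have mh : measurable_fun setT (fun x => t * g x + lam)%R.
  by apply: measurable_funD => //; exact: measurable_funM.
have ipsi : nu.-integrable setT (fun x => conjugate (shift1 phi) (t * g x + lam)%R).
  apply/integrableP; split; first exact: measurable_conjugate_comp.
  by under eq_integral do rewrite gee0_abs ?conjugate_shift_ge0//.
have [Z [mZ nuZ ZP]] := integrable_ae measurableT ipsi.
rewrite addeC -leeBrDr//; apply: ge_ereal_sup => _ [x imx <-].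
rewrite leeBrDr// -EFinD; apply/lee_addgt0Pr => e e0.
have nnull := imx e e0.
(* An essential value is approached within [e] by values of [t g] at points off [Z], where the
   conjugate is finite. *)
have [y [yE yZ]] : exists y, (t * g y)%R \in `]x - e, x + e[%R /\ ~ Z y.
  apply: contrapT => noy; apply: nnull; split.
    rewrite -[X in measurable X]setTI.
    by apply: (measurable_funM (measurable_cst t) mg) => //; exact: measurable_itv.
  apply/eqP; rewrite eq_le measure_ge0 andbT -nuZ le_measure// ?inE//.
    rewrite -[X in measurable X]setTI.
    by apply: (measurable_funM (measurable_cst t) mg) => //; exact: measurable_itv.
  by move=> y /= yx; apply: contrapT => Zy; apply: noy; exists y.
have psiy : conjugate (shift1 phi) (t * g y + lam)%R \is a fin_num.
  by apply: contrapT => H; apply: yZ; apply: ZP => /(_ I).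
have : (t * g y + lam)%:E <= slope_pinfty phi.
  by apply: (conjugate_shift_lty_le hphi); rewrite ltey_eq psiy.
move=> /leeD2r - /(_ e%:E); apply: le_trans; rewrite -EFinD lee_fin.
by move: yE; rewrite in_itv/= => /andP[]; rlra.
Qed.

End cumulant_duality.

(** * Passing affine bounds to suprema and infima *)

Section affine_bounds.
Context {R : realType}.
Implicit Types (A : set (\bar R)) (D S : \bar R).

Lemma sub_ereal_inf_le (r : R) (A : set (\bar R)) (S : \bar R) :
  (forall a, A a -> r%:E - a <= S) -> r%:E - ereal_inf A <= S.
Proof.
case: S => [S||] H; [|exact: leey|].
  have : (r - S)%:E <= ereal_inf A.
    apply: le_ereal_inf_tmp => a /H; case: a => [a||] //=.
    - by rewrite -EFinB !lee_fin => ?; rlra.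
    - by rewrite leey.
  move=> H'; apply: (le_trans (leeB (lexx r%:E) H')).
  by rewrite -EFinB lee_fin; rlra.
suff -> : ereal_inf A = +oo by rewrite addeNy.
apply/eqP; rewrite -leye_eq; apply: le_ereal_inf_tmp => a /H.
by case: a => [a||] //=.
Qed.

(** For [t > 0] the bound passes to the supremum; for [t <= 0] any element [a] of [A] lies below
    [eps], so [t a] is already the larger value. *)
Lemma affine_ereal_sup_le (A : set (\bar R)) (t eps : R) (D S : \bar R) :
  A !=set0 -> (forall a, A a -> a \is a fin_num) ->
  (forall a, A a -> t%:E * a - D <= S) -> ereal_sup A = eps%:E ->
  (eps * t)%:E - D <= S.
Proof.
move=> [a0 Aa0] Afin HS supE.
have ub a : A a -> (fine a <= eps)%R.
  move=> Aa; rewrite -lee_fin fineK ?Afin// -supE.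
  exact: ereal_sup_ubound.
have [t0|t0] := leP t 0%R.
  apply: le_trans (HS _ Aa0); rewrite -(fineK (Afin _ Aa0)) -EFinM.
  by apply: leeB => //; rewrite lee_fin mulrC ler_wnM2l// ub.
case: D HS => [D||] HS; last 2 first.
- by rewrite addeNy leNye.
- have := HS _ Aa0; rewrite -(fineK (Afin _ Aa0)) -EFinM /= leye_eq => /eqP ->.
  by rewrite eqxx.
case: S HS => [S||] HS; [|exact: leey|].
  have : ereal_sup A <= ((S + D) / t)%:E.
    apply: ge_ereal_sup => a Aa; have := HS _ Aa.
    rewrite -(fineK (Afin _ Aa)) -EFinM -EFinB !lee_fin => H.
    by rewrite ler_pdivlMr//; rlra.
  by rewrite supE -EFinB !lee_fin ler_pdivlMr//; rlra.
by have := HS _ Aa0; rewrite -(fineK (Afin _ Aa0)).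
Qed.

Lemma affine_ereal_inf_le (A : set (\bar R)) (t eps : R) (D S : \bar R) :
  A !=set0 -> (forall a, A a -> a \is a fin_num) ->
  (forall a, A a -> t%:E * a - D <= S) -> ereal_inf A = eps%:E ->
  (eps * t)%:E - D <= S.
Proof.
move=> [a0 Aa0] Afin HS infE; rewrite -mulrNN.
apply: (@affine_ereal_sup_le [set - x | x in A]).
- by exists (- a0), a0.
- by move=> _ [a Aa <-]; rewrite fin_numN Afin.
- by move=> _ [a Aa <-]; rewrite EFinN mulNe muleN oppeK; exact: HS.
- by rewrite EFinN -infE /ereal_inf oppeK.
Qed.

End affine_bounds.

(** * The supremum of cumulants as a conjugate *)

Section sup_cumulant_duality.
Context {d : measure_display} {T : measurableType d} {R : realType}.
Variables (phi : R -> \bar R) (P : set (probability T R)) (G : set (T -> R)).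
Hypotheses (hphi : divergence_generator phi)
  (mixP : mixture_closed P) (densP : bounded_density_closed P)
  (intP : forall g mu, G g -> P mu -> mu.-integrable setT (EFin \o g)).

Lemma le_sup_cumulant g mu nu t : G g -> P mu -> P nu ->
  t%:E * mean_gap g mu nu - prob_divergence phi mu nu <=
    sup_cumulant phi P G t.
Proof.
move=> Gg Pmu Pnu.
apply: (le_trans (mean_gap_divergence_le_cumulant hphi t mixP Pmu Pnu
  (intP Gg Pmu) (intP Gg Pnu))).
apply: ge_ereal_sup => _ [rho Prho <-].
by apply: ereal_sup_ubound; exists g, rho.
Qed.

Lemma sup_cumulant_le t (S : \bar R) :
  (forall g mu nu, G g -> P mu -> P nu ->
    t%:E * mean_gap g mu nu - prob_divergence phi mu nu <= S) ->
  sup_cumulant phi P G t <= S.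
Proof.
move=> HS; apply: ge_ereal_sup => _ [g [nu [Gg Pnu ->]]].
apply: (centered_cumulant_le hphi densP Pnu) => mu Pmu; first exact: intP.
exact: HS.
Qed.

Lemma mean_gap_fin g mu nu : G g -> P mu -> P nu -> mean_gap g mu nu \is a fin_num.
Proof. by move=> Gg Pmu Pnu; apply: mean_gap_fin_num; exact: intP. Qed.

(** Both sides are the supremum of [t] times the gap minus the divergence; the conjugate sorts the
    pairs by their gap [eps], which is always finite. *)
Lemma conjugate_inf_lower_bound :
  conjugate (inf_lower_bound phi P G) = sup_cumulant phi P G.
Proof.
apply/funext => t; apply/eqP; rewrite eq_le; apply/andP; split.
  apply: ge_ereal_sup => _ [eps _ <-].
  apply: sub_ereal_inf_le => _ [g Gg <-].
  apply: sub_ereal_inf_le => _ [mu [nu [Pmu Pnu gapE ->]]].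
  rewrite mulrC EFinM -gapE; exact: le_sup_cumulant.
apply: sup_cumulant_le => g mu nu Gg Pmu Pnu.
have := mean_gap_fin Gg Pmu Pnu; case gapE : (mean_gap g mu nu) => [eps||]// _.
apply: (@le_trans _ _ ((eps * t)%:E - inf_lower_bound phi P G eps)).
  rewrite -EFinM mulrC leeB//; apply: (@le_trans _ _ (lower_bound_fun phi P g eps)).
    by apply: ereal_inf_lbound; exists g.
  by apply: ereal_inf_lbound; exists mu, nu.
by apply: ereal_sup_ubound; exists eps.
Qed.

End sup_cumulant_duality.

(** * Closure of sets of probabilities under mixtures and bounded densities *)

Section closures.
Context {d : measure_display} {T : measurableType d} {R : realType}.
Implicit Types (mu nu : probability T R).

(** Otherwise the preimage of the interval would lie in [Z] and be null. *)
Lemma ess_im_witness nu (h : T -> R) (x e : R) (Z : set T) :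
  measurable_fun setT h -> ess_im (null_ideal nu) h x -> (0 < e)%R ->
  measurable Z -> nu Z = 0 -> exists y, h y \in `]x - e, x + e[%R /\ ~ Z y.
Proof.
move=> mh imx e0 mZ nuZ; apply: contrapT => noy; apply: (imx e e0).
have mpre : measurable (h @^-1` `](x - e)%R, (x + e)%R[%classic).
  by rewrite -[X in measurable X]setTI; apply: mh => //; exact: measurable_itv.
split => //; apply/eqP; rewrite eq_le measure_ge0 andbT -nuZ le_measure ?inE//.
by move=> y /= yx; apply: contrapT => Zy; apply: noy; exists y.
Qed.

Lemma density_dominates mu nu (f : T -> R) : measurable_fun setT f ->
  (forall A, mu A = \int[nu]_(x in A) (f x)%:E) -> mu `<< nu.
Proof.
move=> mf muE; apply/null_content_dominatesP => A mA nuA.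
rewrite muE; apply: null_set_integral => //.
exact/measurable_funTS/measurable_EFinP.
Qed.

Lemma radon_nikodym_density mu nu (f : T -> R) : measurable_fun setT f ->
  nu.-integrable setT (EFin \o f) ->
  (forall A, mu A = \int[nu]_(x in A) (f x)%:E) ->
  ae_eq nu setT (radon_nikodym (charge_of_finite_measure mu) nu) f.
Proof.
move=> mf intf muE; have mu_nu := density_dominates mf muE.
apply: (@ae_eq_comp _ _ _ _ _ _ _ fine _ (EFin \o f)).
apply: integral_ae_eq => //.
- exact: Radon_Nikodym_integrable.
- exact/measurable_EFinP.
- by move=> E _ mE; rewrite -Radon_Nikodym_integral// -muE.
Qed.

Lemma bounded_density_integral_lty mu nu (f g : T -> R) (B : R) :
  measurable_fun setT f -> (forall x, 0 <= f x)%R -> (forall x, f x <= B)%R ->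
  (forall A, mu A = \int[nu]_(x in A) (f x)%:E) -> measurable_fun setT g ->
  \int[nu]_x `|(g x)%:E| < +oo -> \int[mu]_x `|(g x)%:E| < +oo.
Proof.
move=> mf f0 fB muE mg gfin.
have mu_nu := density_dominates mf muE.
have mag : measurable_fun setT (fun x => `|(g x)%:E|).
  by apply: measurableT_comp => //; exact/measurable_EFinP.
rewrite -(Radon_Nikodym_SigmaFinite.change_of_variables mu_nu)//.
have intF := Radon_Nikodym_SigmaFinite.f_integrable mu_nu.
have mF : measurable_fun setT (Radon_Nikodym_SigmaFinite.f mu nu).
  exact: measurable_int intF.
have B0 : (0 <= B)%R by exact: le_trans (f0 point) (fB point).
apply: (@le_lt_trans _ _ (B%:E * \int[nu]_x `|(g x)%:E|)); last first.
  have [->|Bn0] := eqVneq B 0%R; first by rewrite mul0e ltry.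
  by rewrite lte_mul_pinfty.
rewrite -ge0_integralZl//.
apply: ae_ge0_le_integral => //.
- by move=> x _; rewrite mule_ge0//; exact: Radon_Nikodym_SigmaFinite.f_ge0.
- exact: emeasurable_funM.
- by move=> x _; rewrite mule_ge0.
- exact: measurable_funeM.
have : ae_eq nu setT (Radon_Nikodym_SigmaFinite.f mu nu) (EFin \o f).
  apply: integral_ae_eq => //; first exact/measurable_EFinP.
  by move=> E _ mE; rewrite -(Radon_Nikodym_SigmaFinite.f_integral mu_nu)// -muE.
by apply: filterS => x /(_ I) -> _; rewrite muleC lee_wpmul2r//= lee_fin fB.
Qed.

Lemma probabilities_in_mixture_closed (X : set (charge T R)) :
  charge_subspace X -> mixture_closed (probabilities_in X).
Proof.
move=> [_ Xadd Xscale] mu nu rho s Xmu Xnu _ rhoE; rewrite /probabilities_in/=.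
have -> : (charge_of_finite_measure rho : charge T R) =
    cadd (cscale (1 - s) (charge_of_finite_measure nu))
         (cscale s (charge_of_finite_measure mu)).
  by apply: charge_ext => A; exact: rhoE.
by apply: Xadd; exact: Xscale.
Qed.

Lemma probabilities_in_bounded_density_closed (X : set (charge T R))
    (Y : set (T -> R)) :
  (forall nu, probabilities_in X nu -> decomposable X Y nu) ->
  bounded_density_closed (probabilities_in X).
Proof.
move=> decXY mu nu f Xnu mf f0 [B fB] muE.
have fB' x : (`|f x| <= B)%R by rewrite ger0_norm.
have mu_nu := density_dominates mf muE.
have [Z [mZ nuZ ZP]] := radon_nikodym_density mf (bounded_integrable nu mf fB') muE.
have mrn : measurable_fun setT (radon_nikodym (charge_of_finite_measure mu) nu).
  by rewrite /radon_nikodym; apply: measurableT_comp.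
apply: (decomp_bounded_density (decXY _ Xnu)) => //; split => //.
(* The extra 1 is the radius within which an essential value is approximated by a value of [f]. *)
exists (B + 1)%R; split; first exact: num_real.
move=> M BM x imx /=.
have [y [yx yZ]] := ess_im_witness mrn imx ltr01 mZ nuZ.
have rny : radon_nikodym (charge_of_finite_measure mu) nu y = f y.
  by apply: contrapT => H; apply: yZ; apply: ZP => /(_ I).
move: yx; rewrite rny in_itv/= => /andP[xf fx].
have := f0 y; have := fB y; rewrite ler_norml => ? ?; apply/andP; split; rlra.
Qed.

Lemma admissible_mixture_closed (Sigma : set (set T)) (G : set (T -> R)) :
  (forall g, G g -> measurable_fun setT g) ->
  mixture_closed (admissible_probabilities Sigma G).
Proof.
move=> mG mu nu rho s [mu0 muG] [nu0 nuG] /andP[s0 s1] rhoE; split.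
  by move=> A SA; rewrite rhoE mu0// nu0// !mule0 adde0.
move=> g Gg.
rewrite (@integral_mixture _ _ _ mu nu rho s)//; last 2 first.
- by rewrite !ltW.
- by apply: measurableT_comp => //; apply/measurable_EFinP; exact: mG.
by rewrite lte_add_pinfty// lte_mul_pinfty ?lee_fin ?subr_ge0 ?ltW ?muG ?nuG.
Qed.

Lemma admissible_bounded_density_closed (Sigma : set (set T)) (G : set (T -> R)) :
  sigma_ideal Sigma -> (forall g, G g -> measurable_fun setT g) ->
  bounded_density_closed (admissible_probabilities Sigma G).
Proof.
move=> [mSigma _ _ _] mG mu nu f [nu0 nuG] mf f0 [B fB] muE; split.
  move=> A SA; have /null_content_dominatesP := density_dominates mf muE; apply.
    exact: mSigma.
  exact: nu0.
move=> g Gg; apply: (bounded_density_integral_lty mf f0 fB muE); first exact: mG.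
exact: nuG.
Qed.

End closures.

(** * Convexity and semicontinuity up to infinity *)

Section convex_limits.
Context {R : realType}.
Implicit Types L : R -> \bar R.

(** Eventual monotonicity turns a bound along an unbounded set into one that holds eventually. *)
Lemma lim_pinfty_le_frequently L (M : \bar R) : ereal_convex_on `[0%R, +oo[ L ->
  (forall b : R, exists2 y, (b <= y)%R & L y <= M) ->
  lim (L y @[y --> +oo%R]) <= M.
Proof.
move=> cL freq; have cvgL := ereal_convex_on_cvg_pinfty cL.
have [b b0 [nd|ni]] := ereal_convex_on_eventually_monotone cL.
  apply: lime_le => //; near=> y.
  have by_ : (b <= y)%R by near: y; apply: nbhs_pinfty_ge; rewrite num_real.
  have [z yz Lz] := freq y.
  exact: le_trans (nd _ _ by_ yz) Lz.
have [z bz Lz] := freq b.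
apply: lime_le => //; near=> y.
have zy : (z <= y)%R by near: y; apply: nbhs_pinfty_ge; rewrite num_real.
exact: le_trans (ni _ _ bz zy) Lz.
Unshelve. all: by end_near. Qed.

(** For finite [y], convexity bounds [L] between 0 and [y]. For [y = +oo], a value [L x > M] would
    force [L z >= L x] for all [z >= x], and the limit would exceed [M]. *)
Lemma extend_pinfty_le_below L (x : R) (y M : \bar R) :
  ereal_convex_on `[0%R, +oo[ L -> L 0%R <= M -> (0 <= x)%R -> x%:E <= y ->
  extend_pinfty L y <= M -> L x <= M.
Proof.
move=> cL L0 x0 xy LM.
have D_ (z : R) : (0 <= z)%R -> `[0%R, +oo[%classic z.
  by move=> ?; rewrite /= in_itv/= andbT.
case: y xy LM => [y||] //=.
  rewrite lee_fin => xy Ly.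
  apply: (ereal_convex_on_le_max cL (D_ 0%R (lexx _)) (D_ y (le_trans x0 xy))) => //.
  by rewrite x0.
move=> _ LM; rewrite leNgt; apply/negP => MLx.
have : L x <= lim (L z @[z --> +oo%R]).
  apply: lime_ge; first exact: ereal_convex_on_cvg_pinfty.
  near=> z.
  have xz : (x <= z)%R by near: z; apply: nbhs_pinfty_ge; rewrite num_real.
  rewrite leNgt; apply/negP => Lzx.
  have : L x <= maxe M (L z).
    apply: (ereal_convex_on_le_max cL (D_ 0%R (lexx _)) (D_ z (le_trans x0 xz))).
    - by rewrite le_max L0.
    - by rewrite le_max lexx orbT.
    - by rewrite x0.
  by rewrite leNgt gt_max MLx Lzx.
by move=> /le_trans /(_ LM); rewrite leNgt MLx.
Unshelve. all: by end_near. Qed.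

(** Lower semicontinuity carries the bound to a finite supremum; if the supremum is infinite, [A] is
    unbounded and the limit of [L] is controlled along it. *)
Lemma extend_pinfty_ereal_sup_le L (A : set R) (M : \bar R) : convex_lsc_ge0 L ->
  A !=set0 -> (forall a, A a -> 0 <= a)%R -> 0 <= M ->
  (forall a, A a -> L a <= M) ->
  extend_pinfty L (ereal_sup [set a%:E | a in A]) <= M.
Proof.
move=> [cL lL] [a0 Aa0] A0 M0 LM.
have sup_ge0 : 0 <= ereal_sup [set a%:E | a in A].
  apply: (@le_trans _ _ a0%:E); first by rewrite lee_fin A0.
  by apply: ereal_sup_ubound; exists a0.
case supE : (ereal_sup _) sup_ge0 => [x||] //=.
  rewrite lee_fin => x0; case: M M0 LM => [D||] //; last by move=> *; exact: leey.
  move=> _ LM; rewrite leNgt; apply/negP => DLx.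
  have [e e0 He] := lsc_ge0_near lL x0 DLx.
  have supfin : ereal_sup [set a%:E | a in A] \is a fin_num by rewrite supE.
  have [_ [a Aa <-]] := ub_ereal_sup_adherent e0 supfin.
  rewrite supE -EFinB lte_fin => xa.
  have ax : (a <= x)%R.
    by rewrite -lee_fin -supE; apply: ereal_sup_ubound; exists a.
  have := He a (A0 _ Aa); rewrite ger0_norm ?subr_ge0// => /(_ ltac:(rlra)).
  by rewrite ltNge LM.
move=> _; apply: lim_pinfty_le_frequently => // b.
have : b%:E < ereal_sup [set a%:E | a in A] by rewrite supE ltry.
move=> /ereal_sup_gt[_ [a Aa <-]]; rewrite lte_fin => /ltW ba.
by exists a => //; exact: LM.
Qed.

End convex_limits.

(** * Lower bounds for families of functions *)

Section families.
Context {d : measure_display} {T : measurableType d} {R : realType}.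
Variables (phi : R -> \bar R) (P : set (probability T R)) (G : set (T -> R)).
Hypotheses (hphi : divergence_generator phi)
  (mixP : mixture_closed P) (densP : bounded_density_closed P)
  (intP : forall g mu, G g -> P mu -> mu.-integrable setT (EFin \o g)).

Lemma conjugate_lower_bound_family_le : G !=set0 -> forall t,
  conjugate (lower_bound_family phi P G) t <= sup_cumulant phi P G t.
Proof.
move=> [g0 Gg0] t; apply: ge_ereal_sup => _ [eps _ <-].
have gaps mu nu : P mu -> P nu -> [/\ [set mean_gap g mu nu | g in G] !=set0,
    (forall a, [set mean_gap g mu nu | g in G] a -> a \is a fin_num) &
    (forall a, [set mean_gap g mu nu | g in G] a ->
       t%:E * a - prob_divergence phi mu nu <= sup_cumulant phi P G t)].
  move=> Pmu Pnu; split; first by exists (mean_gap g0 mu nu), g0.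
    by move=> _ [g Gg <-]; exact: (mean_gap_fin intP).
  by move=> _ [g Gg <-]; exact: le_sup_cumulant.
rewrite /lower_bound_family; case: ifPn => _;
  apply: sub_ereal_inf_le => _ [mu [nu [Pmu Pnu epsE ->]]];
  have [? ? ?] := gaps _ _ Pmu Pnu.
- exact: affine_ereal_sup_le epsE.
- exact: affine_ereal_inf_le epsE.
Qed.

Lemma mean_gap_refl g mu : G g -> P mu -> mean_gap g mu mu = 0.
Proof.
by move=> Gg Pmu; rewrite /mean_gap subee// integrable_fin_num//; exact: intP.
Qed.

(** The bound on [ipm] makes the extremal gaps real at finite divergence. When [t] times the gap of
    [g] is positive, the extremal gap of the same sign serves as [eps], and its product with [t] is
    at least as large. *)
Lemma conjugate_lower_bound_family : G !=set0 ->
  (forall mu nu, P mu -> P nu -> prob_divergence phi mu nu < +oo ->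
     ipm G mu nu < +oo) ->
  conjugate (lower_bound_family phi P G) = sup_cumulant phi P G.
Proof.
move=> G0 ipmfin; apply/funext => t; apply/eqP; rewrite eq_le.
rewrite conjugate_lower_bound_family_le//=.
apply: (sup_cumulant_le hphi densP intP) => g mu nu Gg Pmu Pnu.
have [->|Doo] := eqVneq (prob_divergence phi mu nu) +oo; first by rewrite addeNy leNye.
have D0 := prob_divergence_ge0 hphi mu nu.
have Dfin : prob_divergence phi mu nu \is a fin_num by rewrite ge0_fin_numE// ltey.
(* The pair [(nu, nu)] has zero gaps and zero divergence; this settles the case [t c <= 0]. *)
have conj0 : 0 <= conjugate (lower_bound_family phi P G) t.
  apply: (@le_trans _ _ ((0 * t)%:E - lower_bound_family phi P G 0%R)); last first.
    by apply: ereal_sup_ubound; exists 0%R.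
  rewrite mul0r add0e oppe_ge0 /lower_bound_family lexx.
  apply: ereal_inf_lbound; exists nu, nu; split => //.
    have -> : [set mean_gap g nu nu | g in G] = [set 0].
      apply/seteqP; split => [_ [k Gk <-]|_ ->]; first by rewrite /= mean_gap_refl.
      by exists g => //; rewrite mean_gap_refl.
    by rewrite ereal_sup1.
  by rewrite (prob_divergence_refl hphi).
have ipmoo : ipm G mu nu < +oo by apply: ipmfin => //; rewrite ltey.
have ub k : G k -> `|mean_gap k mu nu| <= ipm G mu nu.
  by move=> Gk; apply: ereal_sup_ubound; exists k.
have gfin := mean_gap_fin intP Gg Pmu Pnu.
set c := mean_gap g mu nu in gfin *.
have [tc0|tc0] := leP (t%:E * c) 0.
  apply: le_trans conj0; rewrite -[leRHS]sube0; exact: leeB.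
suff [eps [tceps lbeps]] : exists eps : R, t%:E * c <= (eps * t)%:E /\
    lower_bound_family phi P G eps <= prob_divergence phi mu nu.
  apply: (@le_trans _ _ ((eps * t)%:E - lower_bound_family phi P G eps)).
    exact: leeB.
  by apply: ereal_sup_ubound; exists eps.
have [c0|c0] := leP 0 c.
  pose s := ereal_sup [set mean_gap g mu nu | g in G].
  have cs : c <= s by apply: ereal_sup_ubound; exists g.
  have sfin : s \is a fin_num.
    rewrite ge0_fin_numE ?(le_trans c0)// (le_lt_trans _ ipmoo)//.
    apply: ge_ereal_sup => _ [k Gk <-]; exact: le_trans (lee_abs _) (ub _ Gk).
  have t0 : (0 <= t)%R.
    rewrite leNgt; apply/negP => t0; move: tc0; apply/negP; rewrite -leNgt.
    by rewrite mule_le0_ge0// lee_fin ltW.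
  exists (fine s); split.
    by rewrite EFinM fineK// muleC lee_wpmul2r.
  rewrite /lower_bound_family -lee_fin fineK// (le_trans c0 cs).
  by apply: ereal_inf_lbound; exists mu, nu; split.
pose s := ereal_inf [set mean_gap g mu nu | g in G].
have sc : s <= c by apply: ereal_inf_lbound; exists g.
have sfin : s \is a fin_num.
  rewrite fin_numElt (le_lt_trans sc) ?(lt_trans c0) ?ltry// andbT.
  apply: (@lt_le_trans _ _ (- ipm G mu nu)); first by rewrite lteNr.
  apply: le_ereal_inf_tmp => _ [k Gk <-]; rewrite leeNl.
  by apply: le_trans (ub _ Gk); rewrite -abseN lee_abs.
have t0 : (t <= 0)%R.
  rewrite leNgt; apply/negP => t0; move: tc0; apply/negP; rewrite -leNgt.
  by rewrite mule_ge0_le0 ?lee_fin ?ltW.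
exists (fine s); split.
  rewrite EFinM fineK// muleC -(fineK gfin) -(fineK sfin) -!EFinM lee_fin.
  by rewrite ler_wnM2r// -lee_fin !fineK.
rewrite /lower_bound_family ifF.
  by apply: ereal_inf_lbound; exists mu, nu; split => //; rewrite fineK.
by apply/negbTE; rewrite -ltNge -lte_fin fineK// (le_lt_trans sc).
Qed.

End families.

(** * Bounds on the divergence against bounds on the cumulants *)

Section lower_bounds.
Context {d : measure_display} {T : measurableType d} {R : realType}.
Variables (phi : R -> \bar R) (P : set (probability T R)) (G : set (T -> R)).
Hypotheses (hphi : divergence_generator phi)
  (mixP : mixture_closed P) (densP : bounded_density_closed P)
  (intP : forall g mu, G g -> P mu -> mu.-integrable setT (EFin \o g)).
Variable L : R -> \bar R.
Hypothesis hL : convex_lsc_ge0 L.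

(** Forwards, the diagonal gives [L 0 <= 0] and convexity carries the bound from [ipm] down to each
    smaller gap; backwards, semicontinuity carries it up to the supremum. *)
Lemma ipm_lower_boundP : G !=set0 ->
  (forall mu nu, P mu -> P nu ->
     extend_pinfty L (ipm G mu nu) <= prob_divergence phi mu nu) <->
  (forall g mu nu, G g -> P mu -> P nu ->
     extend_pinfty L `|mean_gap g mu nu| <= prob_divergence phi mu nu).
Proof.
move=> [g0 Gg0]; have gap0 := mean_gap_refl intP.
split=> [H g mu nu Gg Pmu Pnu|H mu nu Pmu Pnu].
  have L0 : L 0%R <= prob_divergence phi mu nu.
    apply: le_trans (prob_divergence_ge0 hphi mu nu).
    have := H _ _ Pmu Pmu; rewrite (prob_divergence_refl hphi).
    have -> : ipm G mu mu = 0; last by [].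
    have -> : ipm G mu mu = ereal_sup [set 0]; last by rewrite ereal_sup1.
    congr ereal_sup; apply/seteqP; split=> [_ [k Gk <-]|_ ->].
      by rewrite /= gap0// abse0.
    by exists g => //; rewrite gap0// abse0.
  have := mean_gap_fin intP Gg Pmu Pnu.
  case gapE : (mean_gap g mu nu) => [c||]// _ /=.
  apply: (extend_pinfty_le_below (proj1 hL) L0 _ _ (H _ _ Pmu Pnu)) => //.
  by apply: ereal_sup_ubound; exists g => //; rewrite gapE.
have -> : ipm G mu nu =
    ereal_sup [set a%:E | a in [set fine `|mean_gap g mu nu| | g in G]].
  congr ereal_sup; apply/seteqP; split=> [_ [g Gg <-]|_ [_ [g Gg <-] <-]].
    exists (fine `|mean_gap g mu nu|); first by exists g.
    by rewrite fineK// abse_fin_num (mean_gap_fin intP).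
  by exists g => //; rewrite fineK// abse_fin_num (mean_gap_fin intP).
apply: extend_pinfty_ereal_sup_le => //.
- by exists (fine `|mean_gap g0 mu nu|), g0.
- by move=> _ [g Gg <-]; exact: fine_ge0.
- exact: prob_divergence_ge0.
- move=> _ [g Gg <-]; have := H _ _ _ Gg Pmu Pnu.
  have := mean_gap_fin intP Gg Pmu Pnu.
  by case: (mean_gap g mu nu).
Qed.

Lemma gap_lower_bound_cumulant_le :
  (forall g mu nu, G g -> P mu -> P nu ->
     extend_pinfty L `|mean_gap g mu nu| <= prob_divergence phi mu nu) ->
  forall t g nu, G g -> P nu ->
    centered_cumulant phi g nu t <= conjugate_ge0 L `|t|%R.
Proof.
move=> H t g nu Gg Pnu.
apply: (centered_cumulant_le hphi densP Pnu) => mu Pmu; first exact: intP.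
have := H _ _ _ Gg Pmu Pnu; have := mean_gap_fin intP Gg Pmu Pnu.
case gapE : (mean_gap g mu nu) => [c||]// _ /= LD.
apply: (@le_trans _ _ ((`|t| * `|c|)%:E - L `|c|%R)).
  by rewrite -EFinM leeB// lee_fin -normrM ler_norm.
by apply: ereal_sup_ubound; exists `|c|%R => //=; rewrite in_itv/= andbT.
Qed.

Lemma cumulant_le_gap_lower_bound :
  (ereal_inf [set L x | x in `[0%R, +oo[] <= 0 -> L 0%R <= 0) ->
  (forall x, (0 <= x)%R -> -oo < L x) ->
  (forall t g nu, G g -> P nu ->
    centered_cumulant phi g nu t <= conjugate_ge0 L `|t|%R) ->
  forall g mu nu, G g -> P mu -> P nu ->
    extend_pinfty L `|mean_gap g mu nu| <= prob_divergence phi mu nu.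
Proof.
move=> L0 Lny H g mu nu Gg Pmu Pnu.
have weak t mu' nu' : P mu' -> P nu' ->
    t%:E * mean_gap g mu' nu' - prob_divergence phi mu' nu' <=
      conjugate_ge0 L `|t|%R.
  move=> Pmu' Pnu'.
  apply: le_trans (mean_gap_divergence_le_cumulant hphi t mixP Pmu' Pnu'
    (intP Gg Pmu') (intP Gg Pnu')) _.
  by apply: ge_ereal_sup => _ [rho Prho <-]; exact: H.
(* At [t = 0] the diagonal pair shows that the infimum of [L] is at most 0; the hypothesis turns
   this into [L 0 <= 0]. *)
have {}L0 : L 0%R <= 0.
  apply: L0; have := weak 0%R _ _ Pmu Pmu.
  rewrite mul0e (prob_divergence_refl hphi) sube0 normr0 => /le_trans conj0.
  rewrite -oppe_ge0; apply: conj0; apply: ge_ereal_sup => _ [x x0 <-].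
  by rewrite mul0r add0e leeN2; apply: ereal_inf_lbound; exists x.
have := mean_gap_fin intP Gg Pmu Pnu.
case gapE : (mean_gap g mu nu) => [c||]// _ /=.
rewrite leNgt; apply/negP.
have := prob_divergence_ge0 hphi mu nu.
case divE : (prob_divergence phi mu nu) => [D||]//; last first.
  by move=> _; rewrite ltNge leey.
rewrite lee_fin => D0 DL.
(* A height strictly between the divergence and [L |c|]: a line through it below [L] contradicts
   [weak]. *)
have [k Dk kL] : exists2 k : R, (D < k)%R & k%:E < L `|c|%R.
  case Lc : (L `|c|%R) DL => [l||]//; last by exists (D + 1)%R; rewrite ?ltry// ltrDl.
  rewrite lte_fin => Dl; exists ((D + l) / 2)%R; first by rlra.
  by rewrite lte_fin; rlra.
have k0 : (0 < k)%R by rlra.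
have [s s0 sL] := convex_lsc_ge0_separation hL Lny L0 (normr_ge0 c) k0 kL.
have conj_le : conjugate_ge0 L s <= (s * `|c| - k)%:E.
  apply: ge_ereal_sup => _ [y /= + <-]; rewrite in_itv/= andbT => y0.
  apply: (@le_trans _ _ ((s * y)%:E - (k + s * (y - `|c|))%:E)).
    by apply: leeB => //; exact: sL.
  by rewrite -EFinB lee_fin; rlra.
(* [t] has absolute value [s] and the sign of [c]. *)
have [t tc ts] : exists2 t : R, (t * c = s * `|c|)%R & (`|t| = s)%R.
  have [c0|c0] := leP 0%R c.
    by exists s; rewrite !ger0_norm.
  by exists (- s)%R; [rewrite (ltr0_norm c0) mulrN mulNr|rewrite normrN ger0_norm].
have := weak t _ _ Pmu Pnu; rewrite gapE divE -EFinM -EFinB tc ts.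
by move=> /le_trans /(_ conj_le); rewrite lee_fin lerD2l lerN2 leNgt Dk.
Qed.

End lower_bounds.

(** Equality for the family assumes a finite [ipm] at finite divergence, since [lower_bound_family]
    sees only real extremal gaps. In the last implication, nonnegative slopes give only
    [inf L <= 0], while (i) on the diagonal demands [L 0 <= 0]; and a single value [-oo] makes
    [conjugate_ge0 L] identically [+oo], so that (iii) says nothing. *)
Theorem theorem6p2p9 (d : measure_display) (T : measurableType d) (R : realType)
    (hT : exists A : set T, [/\ measurable A, A <> set0 & A <> setT])
    (phi : R -> \bar R) (hphi : divergence_generator phi) :
  (forall (X : set (charge T R)) (Y : set (T -> R)),
     charge_subspace X -> measurable_fun_subspace Y -> dual_pair X Y ->
     (forall nu : probability T R, probabilities_in X nu ->
        decomposable X Y nu) ->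
     forall G : set (T -> R), G !=set0 -> G `<=` Y ->
       [/\ conjugate (inf_lower_bound phi (probabilities_in X) G)
             = sup_cumulant phi (probabilities_in X) G,
           (forall t : R,
              conjugate (lower_bound_family phi (probabilities_in X) G) t
                <= sup_cumulant phi (probabilities_in X) G t) &
           (forall mu nu : probability T R,
              probabilities_in X mu -> probabilities_in X nu ->
              prob_divergence phi mu nu < +oo -> ipm G mu nu < +oo) ->
           conjugate (lower_bound_family phi (probabilities_in X) G)
             = sup_cumulant phi (probabilities_in X) G])
  /\
  (forall (Sigma : set (set T)) (G : set (T -> R)),
     sigma_ideal Sigma -> G !=set0 ->
     (forall g, G g -> measurable_fun setT g) ->
     forall L : R -> \bar R, convex_lsc_ge0 L ->
     let P := admissible_probabilities Sigma G in
     let i := forall mu nu, P mu -> P nu ->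
       extend_pinfty L (ipm G mu nu) <= prob_divergence phi mu nu in
     let ii := forall g mu nu, G g -> P mu -> P nu ->
       extend_pinfty L `|mean_gap g mu nu| <= prob_divergence phi mu nu in
     let iii := forall (t : R) g nu, G g -> P nu ->
       centered_cumulant phi g nu t <= conjugate_ge0 L `|t|%R in
     [/\ i <-> ii,
         ii -> iii &
         (ereal_inf [set L x | x in `[0%R, +oo[] <= 0 -> L 0%R <= 0) ->
         (forall x : R, (0 <= x)%R -> -oo < L x) \/
           (forall x : R, (0 <= x)%R -> L x = -oo) ->
         iii -> i]).
Proof.
split=> [X Y sX sY dXY decXY G G0 GY|Sigma G sSigma G0 mG L hL P].
  have mixP := probabilities_in_mixture_closed sX.
  have densP := probabilities_in_bounded_density_closed decXY.
  have intP g mu : G g -> probabilities_in X mu -> mu.-integrable setT (EFin \o g).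
    move=> Gg Xmu; apply: integrable_variation.
    by have [intXY _ _] := dXY; apply: intXY => //; exact: GY.
  split.
  - exact: conjugate_inf_lower_bound.
  - exact: conjugate_lower_bound_family_le.
  - exact: conjugate_lower_bound_family.
have mixP := @admissible_mixture_closed _ _ _ Sigma G mG.
have densP := admissible_bounded_density_closed sSigma mG.
have intP g mu : G g -> P mu -> mu.-integrable setT (EFin \o g).
  move=> Gg [_ muG]; apply/integrableP; split; last exact: muG.
  by apply/measurable_EFinP; exact: mG.
split.
- exact: ipm_lower_boundP.
- exact: gap_lower_bound_cumulant_le.
- move=> L0 Ldich iii; apply/(ipm_lower_boundP hphi intP hL G0).
  case: Ldich => [Lny|Lnoo].
    exact: (cumulant_le_gap_lower_bound hphi mixP intP hL).
  (* With [L] constantly [-oo] the bound is trivial because gaps are finite. *)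
  move=> g mu nu Gg Pmu Pnu; have := mean_gap_fin intP Gg Pmu Pnu.
  by case: (mean_gap g mu nu) => [c||]// _ /=; rewrite Lnoo// leNye.
Qed.
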